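(* Suppose $x_0, y_0\in \mathbb{R}^n$ are distinct and $x_1, y_1\in \mathbb{R}^n$ are distinct, and assume $u, v\in \mathcal{D}^{1,p}(\mathbb{R}^n)$ are nonconstant extremals with $$[u]_{C^{1-n/p}(\mathbb{R}^n)}=\frac{u(x_0)-u(y_0)}{|x_0-y_0|^{1-n/p}}\quad \text{and}\quad [v]_{C^{1-n/p}(\mathbb{R}^n)}=\frac{v(x_1)-v(y_1)}{|x_1-y_1|^{1-n/p}}.$$ Then for each orthogonal transformation $O$ of $\mathbb{R}^n$ which satisfies $$O\left(\frac{y_0-x_0}{|y_0-x_0|}\right)=\frac{y_1-x_1}{|y_1-x_1|}$$ and each $x\in \mathbb{R}^n$, $$u(x)=\frac{u(y_0)-u(x_0)}{v(y_1)-v(x_1)}\cdot \left\{v\left(\frac{|x_1-y_1|}{|x_0-y_0|} O(x-x_0)+x_1\right)-v(x_1)\right\}+u(x_0).$$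
   Context: Throughout, $n\ge 1$ is an integer and $n<p<\infty$. $\mathcal{D}^{1,p}(\mathbb{R}^n)$ is the space of $u\in L^1_{\mathrm{loc}}(\mathbb{R}^n)$ whose weak first-order partial derivatives all belong to $L^p(\mathbb{R}^n)$. Every such $u$ has a Hölder continuous representative and is always identified with it. Put $[u]_{C^{1-n/p}(\mathbb{R}^n)}:=\sup_{x\ne y}\frac{|u(x)-u(y)|}{|x-y|^{1-n/p}}$ and $\|Du\|_{L^p(\mathbb{R}^n)}:=\left(\int_{\mathbb{R}^n}|Du|^p\,dx\right)^{1/p}$. Morrey's inequality says there is a finite constant $C$ with $[u]_{C^{1-n/p}(\mathbb{R}^n)}\le C\|Du\|_{L^p(\mathbb{R}^n)}$ for all $u\in\mathcal{D}^{1,p}(\mathbb{R}^n)$; $C_*$ denotes the sharp (smallest) such constant. An extremal is a function $u\in\mathcal{D}^{1,p}(\mathbb{R}^n)$ with $[u]_{C^{1-n/p}(\mathbb{R}^n)}=C_*\|Du\|_{L^p(\mathbb{R}^n)}$. *)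

(* Defs.v *)
From HB Require Import structures.
From mathcomp Require Import all_boot all_order all_algebra.
From mathcomp Require Import all_classical all_reals all_analysis.

Set Implicit Arguments.
Unset Strict Implicit.
Unset Printing Implicit Defensive.

Import Order.TTheory GRing.Theory Num.Theory.
Import numFieldNormedType.Exports.

Local Open Scope classical_set_scope.
Local Open Scope ring_scope.

(* Points of R^n are row vectors ['rV[R]_n].  The library norm [`|x|] on
   matrices is the sup norm; it is used below only through the topology it
   induces, and Euclidean lengths are written [enorm]. *)

(* The sigma-algebra on R^n is the one generated by the coordinates. *)

Definition measure_rV_display : measure_display -> measure_display.
Proof. exact. Qed.

Section measurable_rV.
Context {d} {T : measurableType d}.
Variable n : nat.

Definition rV_coor (i : 'I_n) (x : 'rV[T]_n) : T := x ord0 i.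

Let rV_set0 : g_sigma_preimage rV_coor set0.
Proof. exact: sigma_algebra0. Qed.

Let rV_setC A : g_sigma_preimage rV_coor A -> g_sigma_preimage rV_coor (~` A).
Proof. exact: sigma_algebraC. Qed.

Let rV_bigcup (F : _^nat) : (forall i, g_sigma_preimage rV_coor (F i)) ->
  g_sigma_preimage rV_coor (\bigcup_i (F i)).
Proof. exact: sigma_algebra_bigcup. Qed.

HB.instance Definition _ := @isMeasurable.Build (measure_rV_display d)
  'rV[T]_n (g_sigma_preimage rV_coor) rV_set0 rV_setC rV_bigcup.

End measurable_rV.

Lemma measurable_rV_coor d (T : measurableType d) n (i : 'I_n) :
  measurable_fun [set: 'rV[T]_n] (rV_coor i).
Proof.
move=> _ Y mY; rewrite setTI; apply: sub_sigma_algebra => /=.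
rewrite -bigcup_seq/=; exists i => /=; first by rewrite mem_index_enum.
by exists Y => //; rewrite setTI.
Qed.

Lemma measurable_fun_rVP d d' (S : measurableType d') (T : measurableType d) n
    (f : S -> 'rV[T]_n) :
  (forall i, measurable_fun [set: S] (rV_coor i \o f)) ->
  measurable_fun [set: S] f.
Proof.
move=> mf _ A mA; rewrite setTI.
suff : @measurable _ 'rV[T]_n `<=` image_set_system [set: S] f measurable.
  by move=> /(_ _ mA); rewrite /image_set_system/= setTI.
apply: smallest_sub.
  exact/sigma_algebra_image/sigma_algebra_measurable.
move=> B; rewrite -bigcup_seq => -[i _ [C mC <-]].
rewrite /image_set_system /= setTI setTI.
by have := mf i measurableT C mC; rewrite setTI.
Qed.

(* Lebesgue measure on R^n, by recursion: the image of the product of Lebesgue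
   measures on R and R^n under the identification of R * R^n with R^n.+1. *)
Section lebesgue_rV.
Variable R : realType.

Definition rV_cons n (z : measurableTypeR R * 'rV[R]_n) : 'rV[R]_n.+1 :=
  row_mx z.1%:M z.2 : 'rV[R]_(1 + n).

Definition rV_uncons n (x : 'rV[R]_n.+1) : measurableTypeR R * 'rV[R]_n :=
  (x ord0 ord0, rsubmx (x : 'rV[R]_(1 + n))).

Lemma rV_cons0 n (z : measurableTypeR R * 'rV[R]_n) :
  rV_cons z ord0 ord0 = z.1.
Proof.
rewrite /rV_cons (_ : ord0 = lshift n ord0 :> 'I_(1 + n)); last exact/val_inj.
by rewrite (row_mxEl z.1%:M z.2) mxE eqxx mulr1n.
Qed.

Lemma rV_consS n (z : measurableTypeR R * 'rV[R]_n) i :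
  rV_cons z ord0 (lift ord0 i) = z.2 ord0 i.
Proof.
rewrite /rV_cons (_ : lift ord0 i = rshift 1 i :> 'I_(1 + n)).
  by rewrite (row_mxEr z.1%:M z.2).
exact/val_inj.
Qed.

Lemma rV_consK n : cancel (@rV_cons n) (@rV_uncons n).
Proof.
by move=> z; rewrite /rV_uncons rV_cons0 /rV_cons row_mxKr; case: z.
Qed.

Lemma measurable_rV_cons n : measurable_fun setT (@rV_cons n).
Proof.
apply: measurable_fun_rVP => i; have [j ->|->] := unliftP ord0 i.
  rewrite (_ : _ \o _ = rV_coor j \o snd).
    by apply: measurableT_comp; [exact: measurable_rV_coor|
                                exact: measurable_snd].
  by apply/funext => z; exact: rV_consS.
rewrite (_ : _ \o _ = fst); first exact: measurable_fst.
by apply/funext => z; exact: rV_cons0.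
Qed.

Lemma measurable_rV_uncons n : measurable_fun setT (@rV_uncons n).
Proof.
apply/measurable_fun_pairP; split.
  exact: (@measurable_rV_coor _ R n.+1 ord0).
apply: measurable_fun_rVP => i.
rewrite (_ : _ \o _ = rV_coor (rshift 1 i : 'I_n.+1)).
  exact: measurable_rV_coor.
by apply/funext => x; rewrite /rV_coor /= mxE.
Qed.

Section step.
Variables (n : nat) (m : {sigma_finite_measure set 'rV[R]_n -> \bar R}).

Definition lebesgue_rV_step : set 'rV[R]_n.+1 -> \bar R :=
  pushforward (lebesgue_measure \x m)%E (@rV_cons n).

Let push : {measure set 'rV[R]_n.+1 -> \bar R} :=
  measure_function_pushforward__canonical__measure_function_Measure
    (lebesgue_measure \x m)%E (@measurable_rV_cons n).

Let step0 : lebesgue_rV_step set0 = 0%E.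
Proof. exact: (measure0 push). Qed.

Let step_ge0 A : (0 <= lebesgue_rV_step A)%E.
Proof. exact: (measure_ge0 push). Qed.

Let step_sigma_additive : semi_sigma_additive lebesgue_rV_step.
Proof. exact: (@measure_semi_sigma_additive _ _ _ push). Qed.

HB.instance Definition _ := isMeasure.Build _ _ _ lebesgue_rV_step
  step0 step_ge0 step_sigma_additive.

Let step_sigma_finite : sigma_finite setT lebesgue_rV_step.
Proof.
have /sigma_finiteP[F [TF ndF Foo]] := sigma_finiteT (@lebesgue_measure R).
have /sigma_finiteP[G [TG ndG Goo]] := sigma_finiteT m.
have mFG i : measurable (F i `*` G i).
  by apply: measurableX; [have [] := Foo i|have [] := Goo i].
exists (fun i => @rV_uncons n @^-1` (F i `*` G i)).
  rewrite -preimage_bigcup (_ : \bigcup_i _ = setT) ?preimage_setT//.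
  apply/seteqP; split => // -[a y] _.
  have [i _ Fa] : (\bigcup_i F i) a by rewrite -TF.
  have [j _ Gy] : (\bigcup_i G i) y by rewrite -TG.
  exists (maxn i j) => //; split => /=.
    by move: a Fa; exact/subsetPset/ndF/leq_maxl.
  by move: y Gy; exact/subsetPset/ndG/leq_maxr.
move=> i; split.
  by rewrite -[X in measurable X]setTI; exact: measurable_rV_uncons.
rewrite /lebesgue_rV_step /pushforward -comp_preimage.
rewrite (_ : _ \o _ = id); last by apply/funext => z; exact: rV_consK.
have [? ?] := Foo i; have [? ?] := Goo i.
by rewrite preimage_id product_measure1E// lte_mul_pinfty// ge0_fin_numE.
Qed.

HB.instance Definition _ := Measure_isSigmaFinite.Build _ _ _ lebesgue_rV_step
  step_sigma_finite.

End step.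

Fixpoint lebesgue_rV n : {sigma_finite_measure set 'rV[R]_n -> \bar R} :=
  match n return {sigma_finite_measure set 'rV[R]_n -> \bar R} with
  | 0 => \d_(0 : 'rV[R]_0)
  | n'.+1 => lebesgue_rV_step (lebesgue_rV n')
  end.

End lebesgue_rV.

Arguments lebesgue_rV {R n}.

Lemma lebesgue_rV_box (R : realType) n (A : 'I_n -> set (measurableTypeR R)) :
  (forall i, measurable (A i)) ->
  (lebesgue_rV [set x : 'rV[R]_n | forall i, A i (x ord0 i)] =
   \prod_(i < n) lebesgue_measure (A i))%E.
Proof.
elim: n A => [|n ih] A mA.
  rewrite big_ord0 /= diracE mem_set//.
  by case.
rewrite big_ord_recl -ih//= /lebesgue_rV_step /pushforward.
rewrite -product_measure1E//; last first.
  have -> : [set x : 'rV[R]_n | forall i, A (lift ord0 i) (x ord0 i)] =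
      \bigcap_(i in setT) (rV_coor i @^-1` A (lift ord0 i)).
    by apply/seteqP; split => x /= Ax i => [_|]; exact: Ax.
  apply: fin_bigcap_measurable => // i _; rewrite -[X in measurable X]setTI.
  exact: (@measurable_rV_coor _ R n i measurableT _ (mA _)).
congr (product_measure1 _ _ _); apply/seteqP; split => z /=.
  move=> Az; split=> [|i]; first by rewrite -(rV_cons0 z).
  by rewrite -(rV_consS z).
move=> [Az1 Az2] i; have [j ->|->] := unliftP ord0 i.
  by rewrite rV_consS.
by rewrite rV_cons0.
Qed.

Section morrey.
Variables (R : realType) (n : nat).
Implicit Types (x y : 'rV[R]_n) (u f g phi : 'rV[R]_n -> R) (i : 'I_n) (p : R).

Local Notation mu := (@lebesgue_rV R n).

Definition dotp x y : R := \sum_(i < n) x ord0 i * y ord0 i.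

Definition enorm x : R := Num.sqrt (dotp x x).

Definition orthogonal_transformation (O : {linear 'rV[R]_n -> 'rV[R]_n}) :=
  forall x y, dotp (O x) (O y) = dotp x y.

Definition partial i f : 'rV[R]_n -> R := fun x => 'D_(delta_mx ord0 i) f x.

Definition iter_partial (s : seq 'I_n) f : 'rV[R]_n -> R := foldr partial f s.

Definition smooth f := forall s : seq 'I_n,
  continuous (iter_partial s f) /\
  forall i x, derivable (iter_partial s f) x (delta_mx ord0 i).

Definition test_function phi :=
  smooth phi /\ compact (closure [set x | phi x != 0]).

(* [L^1_loc]; [locally_integrable] in the library is restricted to the line. *)
Definition locally_integrable_rV f :=
  measurable_fun [set: 'rV[R]_n] f /\
  forall K : set 'rV[R]_n, compact K ->
    (\int[mu]_(x in K) `|f x|%:E < +oo)%E.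

Definition is_weak_partial i u g :=
  locally_integrable_rV g /\
  forall phi, test_function phi ->
    (\int[mu]_x (u x * partial i phi x)%:E =
     - \int[mu]_x (g x * phi x)%:E)%E.

(* Weak derivatives are unique up to a null set; [weak_partial] is a chosen
   representative, meaningful only when some weak derivative exists. *)
Definition weak_partial i u : 'rV[R]_n -> R :=
  xget (cst 0) [set g | is_weak_partial i u g].

Definition weak_grad u x : 'rV[R]_n := \row_(i < n) weak_partial i u x.

(* [u] is required to be continuous because, for p > n, elements of D^{1,p}
   are identified with their (unique) continuous representatives. *)
Definition D1p p u :=
  [/\ continuous u,
      locally_integrable_rV u &
      forall i, (exists g, is_weak_partial i u g) /\
                weak_partial i u \in Lfun mu p%:E].

Definition norm_Du p u : \bar R :=
  Lnorm mu p%:E (fun x => (enorm (weak_grad u x))%:E).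

Definition holder_quotient p u x y : R :=
  `|u x - u y| / enorm (x - y) `^ (1 - n%:R / p).

Definition holder_seminorm p u : \bar R :=
  ereal_sup [set (holder_quotient p u z.1 z.2)%:E |
             z in [set z : 'rV[R]_n * 'rV[R]_n | z.1 != z.2]].

Definition morrey_inequality p (C : R) := forall u, D1p p u ->
  (holder_seminorm p u <= C%:E * norm_Du p u)%E.

Definition morrey_const p : \bar R :=
  ereal_inf [set C%:E | C in [set C : R | morrey_inequality p C]].

Definition extremal p u :=
  D1p p u /\ holder_seminorm p u = (morrey_const p * norm_Du p u)%E.

Definition nonconstant u := ~ exists c, forall x, u x = c.

End morrey.

(* Main.v *)
Require Import Defs.
From HB Require Import structures.
From mathcomp Require Import all_boot all_order all_algebra.
From mathcomp Require Import all_classical all_reals all_analysis.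
From mathcomp Require Import measurable_realfun ring lra.

Set Implicit Arguments.
Unset Strict Implicit.
Unset Printing Implicit Defensive.

Import Order.TTheory GRing.Theory Num.Theory.
Import numFieldNormedType.Exports.

Local Open Scope classical_set_scope.
Local Open Scope ring_scope.

(* Both sides of the identity have the same Dirichlet norm and attain their
   Hoelder seminorm at (x0, y0): w := c v(T .), with T the similarity carrying
   (x0, y0) to (x1, y1) and c the quotient of the increments, satisfies
   w(x0) - w(y0) = u(x0) - u(y0) and ||Dw|| = ||Du||, by conformal scaling of
   the p-energy under T.  The midpoint z := (u + w) / 2 has the same increment
   between x0 and y0, so C_* ||Dz|| >= [z] >= [u] = C_* ||Du||; strict convexity
   of |.|^p forces Du = Dw almost everywhere.  Morrey's inequality applied to
   u - w then gives [u - w] <= C_* 0 = 0, so u - w is constant.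

   Morrey's inequality itself need not be proved: the existence of a
   nonconstant extremal with finite seminorm makes C_* finite. *)

(** * Borel structure of R^n *)

(** Composing [v] with [T] and multiplying by [c] scales the seminorm and the Dirichlet norm by the
    same factor [c r^(1 - n/p)], where [r = |x1 - y1| / |x0 - y0|]: the gradient contributes [c r]
    and the change of variables [r^(-n/p)]. The orthogonality of [O] ensures that the length of the
    gradient is merely rescaled. The strict convexity comes from [p > 1], a consequence of
    [1 <= n < p].

    Two obstacles account for most of the length. Lebesgue measure is an iterated product, in which
    rotations are invisible; their invariance is derived from translation invariance and Tonelli's
    theorem. And [weak_partial] is a chosen representative, so every formula for a gradient holds
    only almost everywhere and goes through the uniqueness of weak derivatives, for which enough
    test functions have to be built. *)

Section open_boxes.
Variables (R : realType) (n : nat).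
Implicit Types (a b x : 'rV[R]_n) (A : set 'rV[R]_n).

Definition obox a b : set 'rV[R]_n :=
  [set x | forall i, a ord0 i < x ord0 i < b ord0 i].

Lemma measurable_coordinates (A : 'I_n -> set (measurableTypeR R)) :
  (forall i, measurable (A i)) ->
  measurable [set x : 'rV[R]_n | forall i, A i (x ord0 i)].
Proof.
move=> mA; have -> : [set x : 'rV[R]_n | forall i, A i (x ord0 i)] =
    \bigcap_(i in setT) (@rV_coor _ R n i @^-1` A i).
  by apply/seteqP; split => x /= Ax i => [_|]; exact: Ax.
apply: fin_bigcap_measurable => // i _; rewrite -[X in measurable X]setTI.
exact: (@measurable_rV_coor _ R n i measurableT _ (mA _)).
Qed.

Lemma oboxE a b : obox a b =
  [set x | forall i, `]a ord0 i, b ord0 i[%classic (x ord0 i)].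
Proof. by apply/seteqP; split=> x /= h i; have := h i; rewrite in_itv. Qed.

Lemma measurable_obox a b : measurable (obox a b).
Proof.
rewrite oboxE.
by apply: (@measurable_coordinates (fun i => `]a ord0 i, b ord0 i[%classic)) => i.
Qed.

(** The corners are arbitrary, so a box may be empty and the family is stable under intersection
    without a separate case. *)
Definition oboxes : set (set 'rV[R]_n) := [set obox z.1 z.2 | z in setT].

Lemma oboxes_setI : setI_closed oboxes.
Proof.
move=> _ _ [[a b] _ <-] [[c d] _ <-] /=.
exists (\row_i Num.max (a ord0 i) (c ord0 i), \row_i Num.min (b ord0 i) (d ord0 i)) => //=.
apply/seteqP; split=> x /=.
  move=> h; split => i; have := h i; rewrite !mxE gt_max lt_min.
    by move=> /andP[/andP[-> _] /andP[-> _]].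
  by move=> /andP[/andP[_ ->] /andP[_ ->]].
move=> [h1 h2] i; have := h1 i; have := h2 i; rewrite !mxE gt_max lt_min.
by move=> /andP[-> ->] /andP[-> ->].
Qed.

Definition obox_cube (k : nat) : set 'rV[R]_n := obox (const_mx (- k%:R)) (const_mx k%:R).

Lemma bigcup_obox_cube : \bigcup_k obox_cube k = setT.
Proof.
apply/seteqP; split=> // x _.
pose m := \big[Num.max/0]_i `|x ord0 i|.
have mx i : `|x ord0 i| <= m by exact: le_bigmax.
have [k mk] : exists k : nat, m < k%:R.
  by exists (Num.bound m); apply: archi_boundP; exact: bigmax_ge_id.
exists k => // i; rewrite !mxE -ltr_norml; exact: le_lt_trans (mx i) mk.
Qed.

(** Measures are compared, and Dynkin systems generated, on boxes. A box is a finite intersection of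
    coordinate slabs; conversely the half-space [x i > t] is the countable union of the boxes with
    lower corner [t] in direction [i] and [- k] in the others, and the rays []t, +oo[] generate the
    Borel sets of the line. *)
Lemma measurable_rVE : @measurable _ 'rV[R]_n = <<s oboxes >>.
Proof.
apply/seteqP; split; last first.
  apply: smallest_sub; first exact: sigma_algebra_measurable.
  by move=> _ [[a b] _ <-]; exact: measurable_obox.
apply: smallest_sub; first exact: smallest_sigma_algebra.
move=> B; rewrite -bigcup_seq => -[i _ [C mC <-]]; rewrite setTI.
suff sub : @measurable _ (measurableTypeR R) `<=`
    image_set_system setT (@rV_coor _ R n i) <<s oboxes >>.
  by have := sub _ mC; rewrite /image_set_system /= setTI.
rewrite [X in X `<=` _](RGenOInfty.measurableE R); apply: smallest_sub.
  by apply: sigma_algebra_image; exact: smallest_sigma_algebra.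
move=> _ [t ->]; rewrite /image_set_system /= setTI.
rewrite (_ : _ @^-1` _ = \bigcup_k
   (obox (\row_j if j == i then t else - k%:R) (const_mx k%:R))).
  apply: sigma_algebra_bigcup => k; apply: sub_sigma_algebra.
  by exists (\row_j (if j == i then t else - k%:R), const_mx k%:R).
apply/seteqP; split=> x /=.
  rewrite in_itv /= andbT => tx.
  have [k _ xk] : (\bigcup_k obox_cube k) x by rewrite bigcup_obox_cube.
  exists k => // j; have := xk j; rewrite !mxE.
  by case: eqP => [->|//] /andP[_ ->]; rewrite andbT.
by move=> [k _ /(_ i)]; rewrite !mxE eqxx in_itv /= andbT => /andP[].
Qed.

(** Balls of the sup norm are boxes, so an open set is the union of the boxes with rational corners
    that it contains, and there are countably many of them. *)
Lemma open_measurable_rV A : open A -> measurable A.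
Proof.
move=> oA.
pose Q (q : 'rV[rat]_n) : 'rV[R]_n := map_mx ratr q.
rewrite (_ : A = \bigcup_(q : 'rV[rat]_n * 'rV[rat]_n)
   (if `[< obox (Q q.1) (Q q.2) `<=` A >] then obox (Q q.1) (Q q.2) else set0)).
  apply: countable_bigcupT_measurable => [|q]; first exact: countableP.
  by case: ifP => _; [exact: measurable_obox|exact: measurable0].
apply/seteqP; split => [x Ax|x [q _]]; last first.
  by case: ifP => // /asboolP; exact.
have /nbhs_ballP[e /= e0 xeA] : nbhs x A by exact: open_nbhs_nbhs.
have /choice[a ha] : forall i, exists q : rat,
    x ord0 i - e < ratr q < x ord0 i.
  move=> i; have [|q] := @rat_in_itvoo R (x ord0 i - e) (x ord0 i).
    by rewrite ltrBlDr ltrDl.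
  by rewrite in_itv; exists q.
have /choice[b hb] : forall i, exists q : rat,
    x ord0 i < ratr q < x ord0 i + e.
  move=> i; have [|q] := @rat_in_itvoo R (x ord0 i) (x ord0 i + e).
    by rewrite ltrDl.
  by rewrite in_itv; exists q.
exists (\row_i a i, \row_i b i) => //=.
have -> : `[< obox (Q (\row_i a i)) (Q (\row_i b i)) `<=` A >]; last first.
  move=> i; rewrite !mxE; have /andP[_ ->] := ha i.
  by have /andP[-> _] := hb i.
apply/asboolP => y hy; apply: xeA; split => // i j.
rewrite (ord1 i) -ball_normE /= distrC ltr_norml.
have := hy j; rewrite !mxE => /andP[y1 y2].
have /andP[a1 _] := ha j; have /andP[_ b2] := hb j.
by apply/andP; split; [lra|lra].
Qed.

Lemma closed_measurable_rV A : closed A -> measurable A.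
Proof.
move=> cA; rewrite -[A]setCK; apply: measurableC.
by apply: open_measurable_rV; exact: closed_openC.
Qed.

Lemma compact_measurable_rV A : compact A -> measurable A.
Proof.
by move=> cA; apply: closed_measurable_rV; apply: compact_closed.
Qed.

Lemma continuous_measurable_rV (f : 'rV[R]_n -> R) : continuous f ->
  measurable_fun setT f.
Proof.
move=> /continuousP cf; apply: (measurability _ (RGenOpens.measurableE R)).
move=> _ [_ [a [b ->]] <-]; rewrite setTI; apply: open_measurable_rV.
by apply: cf; exact: interval_open.
Qed.

Lemma rV_measure_unique (m1 m2 : {measure set 'rV[R]_n -> \bar R}) :
  (forall a b, m1 (obox a b) = m2 (obox a b)) ->
  (forall a b, (m1 (obox a b) < +oo)%E) ->
  forall A, measurable A -> m1 A = m2 A.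
Proof.
move=> m12 m1oo A mA; apply: (measure_unique oboxes obox_cube) => //.
- exact: measurable_rVE.
- exact: oboxes_setI.
- by move=> k; exists (const_mx (- k%:R), const_mx k%:R).
- exact: bigcup_obox_cube.
- by move=> _ [[a b] _ <-].
by move=> k; exact: m1oo.
Qed.

End open_boxes.

(** * Invariance of Lebesgue measure under translations, rotations and dilations *)

Section lebesgue_invariance.
Variables (R : realType) (n : nat).
Implicit Types (a b x : 'rV[R]_n) (A B : set 'rV[R]_n).
Local Notation mu := (@lebesgue_rV R n).

Lemma lebesgue_rV_obox a b :
  mu (obox a b) = (\prod_(i < n) Num.max 0 (b ord0 i - a ord0 i))%:E.
Proof.
rewrite oboxE (@lebesgue_rV_box _ _ (fun i => `]a ord0 i, b ord0 i[%classic))//.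
rewrite -prodEFin; apply: eq_bigr => i _; rewrite lebesgue_measure_itv /= lte_fin.
case: ltP => [ab|ba]; first by rewrite -EFinB max_r// subr_ge0 ltW.
by rewrite max_l// subr_le0.
Qed.

Lemma lebesgue_rV_obox_lty a b : (mu (obox a b) < +oo)%E.
Proof. by rewrite lebesgue_rV_obox ltry. Qed.

Lemma continuous_rVP (T : topologicalType) m (f : T -> 'rV[R]_m) :
  (forall i, continuous (fun z => f z ord0 i)) -> continuous f.
Proof.
move=> cf z; apply/cvg_ballP => e e0; near=> w; split => // i j.
rewrite (ord1 i) => {i}; move: j; near: w; apply: filter_forall => j.
by have /cvg_ballP/(_ _ e0) := cf j z.
Unshelve. all: by end_near. Qed.

Lemma continuous_mulmxr m (M : 'M[R]_(n, m)) :
  continuous (fun x : 'rV[R]_n => x *m M).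
Proof.
apply: continuous_rVP => i.
rewrite (_ : (fun _ => _) = fun y : 'rV[R]_n => \sum_(j < n) y ord0 j * M j i); last first.
  by apply/funext => y; rewrite mxE.
apply: (@continuous_big R _ +%R 0 predT) => [|j _ x].
  exact: add_continuous.
apply: (@continuousM _ _ (fun y : 'rV[R]_n => y ord0 j) (cst (M j i))).
  exact: coord_continuous.
exact: cst_continuous.
Qed.

Lemma continuous_measurable_rV_rV m (f : 'rV[R]_n -> 'rV[R]_m) :
  continuous f -> measurable_fun setT f.
Proof.
move=> cf; apply: measurable_fun_rVP => i; apply: continuous_measurable_rV => x.
by apply: continuous_comp; [exact: cf|exact: coord_continuous].
Qed.

Lemma measurable_shift_rV a : measurable_fun setT (fun x : 'rV[R]_n => x + a).
Proof.
apply: continuous_measurable_rV_rV => x.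
by apply: (@continuousD _ _ _ id (cst a)) => //; exact: cst_continuous.
Qed.

Lemma lebesgue_rV_shift a A : measurable A ->
  mu ((fun x => x + a) @^-1` A) = mu A.
Proof.
move=> mA; have ma := measurable_shift_rV a.
pose nu : {measure set 'rV[R]_n -> \bar R} :=
  measure_function_pushforward__canonical__measure_function_Measure mu ma.
have preE c d : (fun x => x + a) @^-1` obox c d = obox (c - a) (d - a).
  by apply/seteqP; split => x /= h i; have := h i;
    rewrite !mxE ltrBlDr ltrBrDr.
rewrite [LHS](_ : _ = nu A)//; apply: (@rV_measure_unique R n nu mu) => // c d.
  rewrite /nu /= /pushforward preE !lebesgue_rV_obox; congr EFin.
  by apply: eq_bigr => i _; rewrite !mxE opprB addrA subrK.
by rewrite /nu /= /pushforward preE lebesgue_rV_obox_lty.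
Qed.

Lemma measurable_oppr_rV : measurable_fun setT (fun x : 'rV[R]_n => - x).
Proof. by apply: continuous_measurable_rV_rV; exact: opp_continuous. Qed.

(* Both sides compute the [mu \x nu]-measure of the pairs [(x, y)] with
   [x + y \in A] and [y \in B]: integrating in [x] first gives the left-hand
   side; shifting [y := z - x] and then integrating in [x] first gives the
   right-hand side.  For a rotation-invariant [B] this makes [nu], the image of
   [mu] under a rotation, equal to [mu]. *)
Lemma translation_invariant_exchange
    (nu : {sigma_finite_measure set 'rV[R]_n -> \bar R}) A B :
  (forall a C, measurable C -> nu ((fun x => x + a) @^-1` C) = nu C) ->
  measurable A -> measurable B ->
  (mu A * nu B = nu A * mu ((fun x => - x)%R @^-1` B))%E.
Proof.
move=> nuT mA mB.
have mpre (f : 'rV[R]_n -> 'rV[R]_n) C : measurable_fun setT f -> measurable C ->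
    measurable (f @^-1` C).
  by move=> mf mC; rewrite -[X in measurable X]setTI; exact: mf.
pose g1 (z : 'rV[R]_n * 'rV[R]_n) : \bar R :=
  ((\1_B z.2)%:E * (\1_A (z.1 + z.2)%R)%:E)%E.
pose g2 (z : 'rV[R]_n * 'rV[R]_n) : \bar R :=
  ((\1_A z.2)%:E * (\1_B (z.2 - z.1)%R)%:E)%E.
have m1 : measurable_fun [set: 'rV[R]_n * 'rV[R]_n] g1.
  apply/measurable_EFinP; apply: measurable_funM.
    by apply: measurableT_comp => //; exact: measurable_snd.
  apply: measurableT_comp => //; apply: measurable_fun_rVP => i.
  rewrite (_ : _ \o _ = fun z : 'rV[R]_n * 'rV[R]_n =>
      z.1 ord0 i + z.2 ord0 i); last first.
    by apply/funext => z; rewrite /rV_coor /= !mxE.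
  apply: measurable_funD.
    exact: (measurableT_comp (measurable_rV_coor i) measurable_fst).
  exact: (measurableT_comp (measurable_rV_coor i) measurable_snd).
have m2 : measurable_fun [set: 'rV[R]_n * 'rV[R]_n] g2.
  apply/measurable_EFinP; apply: measurable_funM.
    by apply: measurableT_comp => //; exact: measurable_snd.
  apply: measurableT_comp => //; apply: measurable_fun_rVP => i.
  rewrite (_ : _ \o _ = fun z : 'rV[R]_n * 'rV[R]_n =>
      z.2 ord0 i - z.1 ord0 i); last first.
    by apply/funext => z; rewrite /rV_coor /= !mxE.
  apply: measurable_funB.
    exact: (measurableT_comp (measurable_rV_coor i) measurable_snd).
  exact: (measurableT_comp (measurable_rV_coor i) measurable_fst).
have int_ind (m : {measure set 'rV[R]_n -> \bar R}) C (k : \bar R) :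
    measurable C -> (0 <= k)%E -> (\int[m]_x (k * (\1_C x)%:E) = k * m C)%E.
  move=> mC k0; rewrite ge0_integralZl//; last exact/measurable_EFinP.
  by rewrite integral_indic// setIT.
have g1_ge0 z : (0 <= g1 z)%E by rewrite mule_ge0// lee_fin.
have g2_ge0 z : (0 <= g2 z)%E by rewrite mule_ge0// lee_fin.
transitivity (\int[nu]_y \int[mu]_x g1 (x, y))%E.
  rewrite -int_ind//; apply: eq_integral => y _.
  rewrite /g1 /= (int_ind mu ((fun x => x + y) @^-1` A)) ?lee_fin//; last first.
    by apply: mpre => //; exact: measurable_shift_rV.
  by rewrite muleC; congr (_ * _)%E; exact/esym/lebesgue_rV_shift.
rewrite -fubini_tonelli//.
transitivity (\int[mu]_x \int[nu]_y g2 (x, y))%E.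
  apply: eq_integral => x _.
  pose C := A `&` (fun y => y - x) @^-1` B.
  have mC : measurable C.
    by apply: measurableI => //; apply: mpre => //; exact: measurable_shift_rV.
  transitivity (nu ((fun y => y + x) @^-1` C)).
    rewrite -[RHS]mul1e -int_ind//; last first.
      by apply: mpre => //; exact: measurable_shift_rV.
    apply: eq_integral => y _; rewrite mul1e /g1 /= -EFinM preimage_setI indicI /=.
    have indic_pre (f : 'rV[R]_n -> 'rV[R]_n) D w : \1_(f @^-1` D) w = \1_D (f w) :> R.
      by rewrite !indicE; congr (_%:R); apply/idP/idP; rewrite !inE.
    rewrite mulrC; congr ((_ * _)%:E).
      by rewrite addrC; exact/esym/(indic_pre (fun w => w + x)).
    rewrite -[in LHS](addrK x y); apply/esym.
    exact: etrans (indic_pre (fun w => w + x) _ _) (indic_pre (fun w => w - x) _ _).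
  rewrite nuT// -[LHS]mul1e -int_ind//; apply: eq_integral => y _.
  by rewrite mul1e /g2 /= -EFinM indicI.
rewrite fubini_tonelli// muleC -int_ind//; apply: eq_integral => z _.
rewrite /g2 /= (int_ind mu ((fun x => z - x) @^-1` B)) ?lee_fin//; last first.
  rewrite (_ : (fun x => z - x) = (fun x => x + z) \o (fun x => - x)).
    apply: mpre => //; apply: measurableT_comp; first exact: measurable_shift_rV.
    exact: measurable_oppr_rV.
  by apply/funext => x /=; rewrite addrC.
rewrite muleC; congr (_ * _)%E.
(* The points [x] with [z - x] in [B] form a translate of the reflected set [- B]; this is the
   origin of the reflection on the right-hand side. *)
rewrite -[in RHS](@lebesgue_rV_shift (- z)); last first.
  by apply: mpre => //; exact: measurable_oppr_rV.
by congr (mu _); apply/funext => x /=; rewrite opprB.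
Qed.

Lemma dotpE x y : dotp x y = (x *m y^T) ord0 ord0.
Proof. by rewrite mxE; apply: eq_bigr => i _; rewrite !mxE. Qed.

Lemma dotpNN x y : dotp (- x) (- y) = dotp x y.
Proof. by apply: eq_bigr => i _; rewrite !mxE mulrNN. Qed.

Lemma dotp_mulmx (Q : 'M[R]_n) x y : Q *m Q^T = 1%:M ->
  dotp (x *m Q) (y *m Q) = dotp x y.
Proof. by move=> hQ; rewrite !dotpE trmx_mul mulmxA -(mulmxA x) hQ mulmx1. Qed.

Lemma continuous_dotp : continuous (fun x : 'rV[R]_n => dotp x x).
Proof.
apply: (@continuous_big R _ +%R 0 predT) => [|j _ x]; first exact: add_continuous.
by apply: (@continuousM _ _ (fun y : 'rV[R]_n => y ord0 j)
  (fun y : 'rV[R]_n => y ord0 j)); exact: coord_continuous.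
Qed.

Lemma dotp_ge0 x : 0 <= dotp x x.
Proof. by apply: sumr_ge0 => i _; rewrite -expr2 sqr_ge0. Qed.

Lemma sqr_coord_le_dotp x i : x ord0 i ^+ 2 <= dotp x x.
Proof.
rewrite /dotp (bigD1 i)//= -expr2 lerDl; apply: sumr_ge0 => j _.
by rewrite -expr2 sqr_ge0.
Qed.

(** The Euclidean ball is the test set for the exchange identity: it is fixed by rotations and by
    the reflection, and its measure is positive and finite, hence can be cancelled. *)
Let unit_ball : set 'rV[R]_n := [set x | dotp x x < 1].

Let measurable_unit_ball : measurable unit_ball.
Proof.
apply: open_measurable_rV; have /continuousP := continuous_dotp.
by move/(_ _ (@open_lt R 1)).
Qed.

Let unit_ball_lty : (mu unit_ball < +oo)%E.
Proof.
apply: le_lt_trans (lebesgue_rV_obox_lty (const_mx (- 1)) (const_mx 1)).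
apply: le_measure; rewrite ?inE//; first exact: measurable_obox.
move=> x /= x1 i; rewrite !mxE -ltr_norml -(@ltr_pXn2r _ 2%N) ?nnegrE// expr1n.
by rewrite real_normK ?num_real//; exact: le_lt_trans (sqr_coord_le_dotp x i) x1.
Qed.

Let unit_ball_gt0 : (0 < mu unit_ball)%E.
Proof.
(* If every [|x i|] is below [c <= 1], then every square is at most [c], and the sum of squares is
   at most [n / (n + 1) < 1]. *)
pose c : R := n.+1%:R^-1.
have c0 : 0 < c by rewrite invr_gt0.
apply: (@lt_le_trans _ _ (mu (obox (const_mx (- c)) (const_mx c)))).
  rewrite lebesgue_rV_obox lte_fin; apply: prodr_gt0 => i _.
  by rewrite !mxE lt_max opprK addr_gt0 ?orbT.
apply: le_measure; rewrite ?inE//; first exact: measurable_obox.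
move=> x hx; apply: (@le_lt_trans _ _ (\sum_(i < n) c)).
  apply: ler_sum => i _; have := hx i; rewrite !mxE -ltr_norml => xc.
  rewrite (le_trans (ler_norm _))// normrM -[leRHS]mulr1 ler_pM// ?ltW//.
  by apply: lt_le_trans xc _; rewrite invf_le1 ?ler1n ?ltr0n.
by rewrite sumr_const card_ord -[ltLHS]mulr_natr mulrC ltr_pdivrMr// mul1r ltr_nat.
Qed.

Section rotation.
Variable Q : 'M[R]_n.
Hypothesis QQ1 : Q *m Q^T = 1%:M.

Let nu := pushforward mu (fun x : 'rV[R]_n => x *m Q).

Let mQ : measurable_fun setT (fun x : 'rV[R]_n => x *m Q).
Proof. by apply: continuous_measurable_rV_rV; exact: continuous_mulmxr. Qed.

Let nu' : {measure set 'rV[R]_n -> \bar R} :=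
  measure_function_pushforward__canonical__measure_function_Measure mu mQ.

Let nu_obox_lty a b : (nu (obox a b) < +oo)%E.
Proof.
(* [M] bounds every coordinate of a point [x] whose image [x *m Q] lies in the box, because [x] is
   recovered as [(x *m Q) *m Q^T]. Summing over [i] makes the bound independent of the coordinate,
   and the added 1 makes it strict. *)
pose M : R := 1 + \sum_(i < n) \sum_(j < n)
  (`|a ord0 j| + `|b ord0 j|) * `|Q^T j i|.
rewrite /nu /pushforward.
apply: le_lt_trans (lebesgue_rV_obox_lty (const_mx (- M)) (const_mx M)).
apply: le_measure; rewrite ?inE//; last 2 first.
- exact: measurable_obox.
- move=> x /= hx i; rewrite !mxE -ltr_norml.
  have -> : x = (x *m Q) *m Q^T by rewrite -mulmxA QQ1 mulmx1.
  rewrite mxE; apply: le_lt_trans (ler_norm_sum _ _ _) _.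
  rewrite /M [X in _ < 1 + X](bigD1 i)//= ltr_pwDl// -[leLHS]addr0 lerD//; last first.
    by apply: sumr_ge0 => j _; apply: sumr_ge0 => k _; rewrite mulr_ge0 ?addr_ge0.
  apply: ler_sum => j _; rewrite normrM ler_wpM2r//.
  have /andP[h1 h2] := hx j; rewrite ler_norml.
  have := ler_norm (- a ord0 j); have := ler_norm (b ord0 j).
  have := normr_ge0 (a ord0 j); have := normr_ge0 (b ord0 j).
  rewrite normrN => *; apply/andP; split; lra.
by rewrite -[X in measurable X]setTI; apply: mQ => //; exact: measurable_obox.
Qed.

Let nu_sigma_finite : sigma_finite setT nu.
Proof.
exists (@obox_cube R n); first by rewrite bigcup_obox_cube.
by move=> k; split; [exact: measurable_obox|exact: nu_obox_lty].
Qed.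

(** The image measure [nu] is again translation invariant, so the exchange identity with [B] the
    unit ball reads [mu A * mu B = nu A * mu B]; then [mu B] is divided out. *)
Lemma lebesgue_rV_rotation A : measurable A ->
  mu ((fun x => x *m Q) @^-1` A) = mu A.
Proof.
move=> mA.
pose nus : {sigma_finite_measure set 'rV[R]_n -> \bar R} :=
  HB.pack nu (Measure.on nu') (Measure_isSigmaFinite.Build _ _ _ nu nu_sigma_finite).
have nuT a C : measurable C -> nu ((fun x => x + a) @^-1` C) = nu C.
  move=> mC; rewrite /nu /pushforward.
  (* A translation by [a] after the rotation is a translation by [a *m Q^T] before it. *)
  rewrite -[RHS](@lebesgue_rV_shift (a *m Q^T)); last first.
    by rewrite -[X in measurable X]setTI; exact: mQ.
  congr (mu _); apply/funext => x /=.
  by rewrite mulmxDl -mulmxA (mulmx1C QQ1) mulmx1.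
have := translation_invariant_exchange (nu := nus) nuT mA measurable_unit_ball.
have -> : nus unit_ball = mu unit_ball.
  by congr (mu _); apply/seteqP; split => x; rewrite /unit_ball /= dotp_mulmx.
have -> : (fun x => - x) @^-1` unit_ball = unit_ball.
  by apply/seteqP; split => x; rewrite /unit_ball /= dotpNN.
have bfin : mu unit_ball \is a fin_num by rewrite ge0_fin_numE.
have b0 : fine (mu unit_ball) != 0.
  by rewrite gt_eqF// -lte_fin fineK.
rewrite -(fineK bfin) => /(congr1 (fun z => z * ((fine (mu unit_ball))^-1)%:E)%E).
by rewrite -!muleA -!EFinM !divff// !mule1 => ->.
Qed.

End rotation.

Lemma lebesgue_rV_scale (r : R) A : 0 < r -> measurable A ->
  (mu ((fun x => r *: x) @^-1` A) = (r^-1 ^+ n)%:E * mu A)%E.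
Proof.
move=> r0 mA.
have mr : measurable_fun setT (fun x : 'rV[R]_n => r *: x).
  by apply: continuous_measurable_rV_rV; exact: scaler_continuous.
pose nu : {measure set 'rV[R]_n -> \bar R} :=
  measure_function_pushforward__canonical__measure_function_Measure mu mr.
have rn : 0 <= r^-1 ^+ n by rewrite exprn_ge0// invr_ge0 ltW.
pose m2 : {measure set 'rV[R]_n -> \bar R} := mscale (NngNum rn) mu.
have preE c d : (fun x => r *: x) @^-1` obox c d = obox (r^-1 *: c) (r^-1 *: d).
  apply/seteqP; split => x /= h i; have := h i; rewrite !mxE;
    by rewrite ltr_pdivrMl// ltr_pdivlMl.
rewrite [LHS](_ : _ = nu A)//.
rewrite (@rV_measure_unique R n nu m2)// => c d.
  rewrite /nu /= /pushforward preE /m2 /mscale /= !lebesgue_rV_obox -EFinM; congr EFin.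
  rewrite -[X in r^-1 ^+ X]card_ord -prodr_const -big_split /=; apply: eq_bigr => i _.
  by rewrite !mxE -mulrBr maxr_pMr ?mulr0// invr_ge0 ltW.
by rewrite /nu /= /pushforward preE lebesgue_rV_obox_lty.
Qed.

End lebesgue_invariance.

(** * Change of variables along similarities *)

Section change_of_variables.
Variables (R : realType) (n : nat) (r : R) (Q : 'M[R]_n) (b : 'rV[R]_n).
Hypotheses (r0 : 0 < r) (QQ1 : Q *m Q^T = 1%:M).
Local Notation mu := (@lebesgue_rV R n).

Definition similarity (x : 'rV[R]_n) : 'rV[R]_n := r *: (x *m Q) + b.

Lemma continuous_similarity : continuous similarity.
Proof.
move=> x.
apply: (@continuousD _ _ _ (fun y : 'rV[R]_n => r *: (y *m Q)) (cst b)).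
  apply: (@continuous_comp _ _ _ (fun y : 'rV[R]_n => y *m Q) (fun y => r *: y)).
    exact: continuous_mulmxr.
  exact: scaler_continuous.
exact: cst_continuous.
Qed.

Lemma measurable_similarity : measurable_fun setT similarity.
Proof. by apply: continuous_measurable_rV_rV; exact: continuous_similarity. Qed.

Lemma lebesgue_rV_similarity (A : set 'rV[R]_n) : measurable A ->
  (mu (similarity @^-1` A) = (r^-1 ^+ n)%:E * mu A)%E.
Proof.
move=> mA.
have mA1 : measurable ((fun x : 'rV[R]_n => x + b) @^-1` A).
  by rewrite -[X in measurable X]setTI; exact: measurable_shift_rV.
have mA2 : measurable ((fun x : 'rV[R]_n => r *: x) @^-1` ((fun x => x + b) @^-1` A)).
  rewrite -[X in measurable X]setTI.
  by apply: continuous_measurable_rV_rV => //; exact: scaler_continuous.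
transitivity (mu ((fun x : 'rV[R]_n => x *m Q) @^-1`
    ((fun x => r *: x) @^-1` ((fun x => x + b) @^-1` A)))).
  by congr (mu _); apply/funext.
rewrite (lebesgue_rV_rotation QQ1 mA2) (lebesgue_rV_scale r0 mA1).
by rewrite lebesgue_rV_shift.
Qed.

Lemma ge0_integral_similarity (f : 'rV[R]_n -> \bar R) :
  measurable_fun setT f -> (forall x, 0 <= f x)%E ->
  (\int[mu]_x f (similarity x) = (r^-1 ^+ n)%:E * \int[mu]_x f x)%E.
Proof.
move=> mf f0.
have rn : 0 <= r^-1 ^+ n by rewrite exprn_ge0// invr_ge0 ltW.
transitivity (\int[pushforward mu similarity]_x f x)%E.
  by rewrite (ge0_integral_pushforward measurable_similarity).
rewrite (@eq_measure_integral _ _ _ _ (mscale (NngNum rn) mu)).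
- by rewrite ge0_integral_mscale.
- exact: measurable_similarity.
- by move=> mS A mA _; exact: lebesgue_rV_similarity.
Qed.

(** The nonnegative case applies to the positive and the negative part. A positive finite factor
    distributes over their difference, also in the case [+oo - +oo], which has the value [-oo] on
    both sides. *)
Lemma integral_similarity (f : 'rV[R]_n -> \bar R) : measurable_fun setT f ->
  (\int[mu]_x f (similarity x) = (r^-1 ^+ n)%:E * \int[mu]_x f x)%E.
Proof.
move=> mf; rewrite integralE [in RHS]integralE.
rewrite (_ : (fun x => f (similarity x))^\+%E = fun x => f^\+%E (similarity x)); last first.
  by apply/funext => x; rewrite ?funeposE ?funenegE.
rewrite (_ : (fun x => f (similarity x))^\-%E = fun x => f^\-%E (similarity x)); last first.
  by apply/funext => x; rewrite ?funeposE ?funenegE.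
rewrite !ge0_integral_similarity//; last 2 first.
- exact: measurable_funeneg.
- exact: measurable_funepos.
have k0 : (0 < (r^-1 ^+ n)%:E)%E by rewrite lte_fin exprn_gt0// invr_gt0.
set s := (\int[mu]_x f^\-%E x)%E; set t := (\int[mu]_x f^\+%E x)%E.
have : (0 <= s)%E by exact: integral_ge0.
have : (0 <= t)%E by exact: integral_ge0.
case: s => [s||]; case: t => [t||] // _ _.
- by rewrite -!EFinM mulrBr.
- by rewrite addye// !gt0_muley// -EFinM addye.
- by rewrite addeNy gt0_muleNy// gt0_muley// -EFinM addeNy.
- by rewrite addeNy gt0_muleNy// gt0_muley// addeNy.
Qed.

End change_of_variables.

(** * Directional derivatives and smooth functions *)

Section directional_derivatives.
Variable R : realType.

(** On the line through [x] along [v] the map [L] moves with constant velocity [w], so the two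
    difference quotients are the same function of [h]. This serves for lines [s *: v + y] as well as
    for similarities and coordinate functions. *)
Lemma derive_affine_comp (V W : normedModType R) (f : W -> R) (L : V -> W) x v w :
  (forall h : R, L (h *: v + x) = h *: w + L x) ->
  (derivable (f \o L) x v = derivable f (L x) w) *
  ('D_v (f \o L) x = 'D_w f (L x)).
Proof.
move=> hL.
have E : (fun h : R => h^-1 *: (((f \o L) \o shift x) (h *: v) - (f \o L) x)) =
    (fun h : R => h^-1 *: ((f \o shift (L x)) (h *: w) - f (L x))).
  by apply/funext => h /=; rewrite hL.
by rewrite /derivable /derive E.
Qed.

Lemma is_derive_line (V : normedModType R) (f : V -> R) y v t :
  derivable f (t *: v + y) v ->
  is_derive t 1 (fun s : R => f (s *: v + y)) ('D_v f (t *: v + y)).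
Proof.
move=> df; have [E1 E2] := @derive_affine_comp R^o V f (fun s : R => s *: v + y) t 1 v
  (fun h => ltac:(by rewrite scaler1 scalerDl addrA)).
by split; [rewrite E1|rewrite E2].
Qed.

(** The chain rule in one variable, for [s |-> f (s *: v + x)] after [s |-> a * s]; this treats
    [a = 0] on the same footing. *)
Lemma is_derive_scale_dir (V : normedModType R) (f : V -> R) x v (a : R) :
  derivable f x v -> is_derive x (a *: v) f (a * 'D_v f x).
Proof.
move=> df.
have d0 : is_derive (0 : R) 1 (fun s : R => f (s *: v + x)) ('D_v f x).
  have := @is_derive_line V f x v 0; rewrite scale0r add0r; exact.
have da : is_derive (0 : R) 1 (fun s : R => a * s) a.
  by apply: is_derive_eq; rewrite [LHS]mulr1.
have := @is_derive1_comp R (fun s => f (s *: v + x)) (fun s => a * s) 0 ('D_v f x) a.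
rewrite mulr0 => /(_ d0 da) [d1 d2].
have hL (h : R) : (a * (h *: (1 : R^o) + 0)) *: v + x =
    h *: (a *: v) + ((a * 0) *: v + x).
  by rewrite addr0 [h *: _]mulr1 mulr0 scale0r add0r scalerA mulrC.
have [E1 E2] := @derive_affine_comp R^o V f (fun s : R => (a * s) *: v + x) 0 1 (a *: v) hL.
move: E1 E2; rewrite mulr0 scale0r add0r => E1 E2.
by split; [rewrite -E1|rewrite -E2 mulrC].
Qed.

(* By the mean value theorem the increment along [v] at the moving base point
   [x + h w] is [h * 'D_v f] at a nearby point; hence only the derivative along
   [v] has to be continuous. *)
Lemma is_derive_add_dir (V : normedModType R) (f : V -> R) x v w :
  (forall y, derivable f y v) -> derivable f x w ->
  {for x, continuous (fun y => 'D_v f y)} ->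
  is_derive x (v + w) f ('D_v f x + 'D_w f x).
Proof.
move=> dv dw cv.
have mvt (h : R) y : exists2 c, `|c| <= 1 &
    f (h *: v + y) - f y = h * 'D_v f ((c * h) *: v + y).
  have dl (t : R) : is_derive t 1 (fun s : R => f (s *: (h *: v) + y))
      ('D_(h *: v) f (t *: (h *: v) + y)).
    apply: is_derive_line.
    by have [] := @is_derive_scale_dir V f (t *: (h *: v) + y) v h (dv _).
  have [c c01 E] := @MVT R _ _ 0 1 ltr01 (fun t _ => dl t)
    (derivable_within_continuous (fun t _ => ltac:(by have [] := dl t))).
  exists c; first by move: c01; rewrite in_itv /= => /andP[c0 c1]; rewrite gtr0_norm// ltW.
  move: E; rewrite scale1r scale0r add0r subr0 mulr1 => ->.
  by have [_ ->] := @is_derive_scale_dir V f (c *: (h *: v) + y) v h (dv _); rewrite scalerA.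
suff lim1 : (fun h : R => h^-1 *: (f (h *: v + (h *: w + x)) - f (h *: w + x)))
    @ 0^' --> 'D_v f x.
  suff H : (fun h : R => h^-1 *: ((f \o shift x) (h *: (v + w)) - f x)) @ 0^' -->
      'D_v f x + 'D_w f x.
    by split; [apply/cvg_ex; exists ('D_v f x + 'D_w f x)|exact/cvg_lim].
  rewrite [X in X @ _](_ : _ =
      (fun h : R => h^-1 *: (f (h *: v + (h *: w + x)) - f (h *: w + x))) +
      (fun h : R => h^-1 *: ((f \o shift x) (h *: w) - f x))).
    exact: cvgD lim1 dw.
apply/funext => h; rewrite fctE -[RHS]scalerDr; congr (_ *: _).
  by rewrite addrA subrK scalerDr addrA.
apply/cvgrPdist_lt => e e0.
have /cvgrPdist_lt/(_ _ e0) := cv; move=> /nbhs_ballP[d /= d0 hd].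
(* The mean value point differs from [x] by at most [|h| (|v| + |w|)]; the added 1 keeps [K]
   positive when both directions vanish. *)
pose K := `|v| + `|w| + 1.
have K0 : 0 < K by rewrite ltr_wpDl// addr_ge0.
near=> h.
have h0 : h != 0 by near: h; exact: nbhs_dnbhs_neq.
have [c c1 ->] := mvt h (h *: w + x).
rewrite [_ *: _]mulrA mulVf// mul1r; apply: hd.
rewrite -ball_normE /= distrC addrA addrK.
apply: (le_lt_trans (ler_normD _ _)); rewrite !normrZ.
apply: (@le_lt_trans _ _ (`|h| * K)).
  rewrite /K !mulrDr mulr1 -addrA lerD//; last by rewrite lerDl.
  by rewrite ler_wpM2r// ler_piMl.
rewrite -ltr_pdivlMr//; near: h; apply: dnbhs0_lt; exact: divr_gt0.
Unshelve. all: by end_near. Qed.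

End directional_derivatives.

Section smooth_functions.
Variables (R : realType) (n : nat).
Implicit Types (f g : 'rV[R]_n -> R) (x v : 'rV[R]_n) (i : 'I_n).
Local Notation e i := (delta_mx ord0 i : 'rV[R]_n).

(* [smooth] is the largest class of continuous functions on which all partial
   derivatives exist and stay in the class. *)
Lemma smooth_coind (P : ('rV[R]_n -> R) -> Prop) :
  (forall f, P f -> continuous f) ->
  (forall f, P f -> forall i x, derivable f x (e i)) ->
  (forall f, P f -> forall i, P (partial i f)) ->
  forall f, P f -> smooth f.
Proof.
move=> Pc Pd Pp f Pf s; have Ps : P (iter_partial s f) by elim: s => //= i s IH; exact: Pp.
by split; [exact: Pc|exact: Pd].
Qed.

Lemma smooth_continuous f : smooth f -> continuous f.
Proof. by move=> /(_ [::]) []. Qed.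

Lemma smooth_derivable f i x : smooth f -> derivable f x (e i).
Proof. by move=> /(_ [::]) []. Qed.

Lemma smooth_partial f i : smooth f -> smooth (partial i f).
Proof.
move=> sf s; have -> : iter_partial s (partial i f) = iter_partial (rcons s i) f.
  by rewrite /iter_partial foldr_rcons.
exact: sf.
Qed.

Lemma smooth_cst (c : R) : smooth (cst c : 'rV[R]_n -> R).
Proof.
apply: (@smooth_coind (fun f => exists c, f = cst c)) => [_ [d ->]|_ [d ->] i x|_ [d ->] i|].
- exact: cst_continuous.
- exact: derivable_cst.
- by exists 0; apply/funext => x; rewrite /partial derive_cst.
by exists c.
Qed.

(** The Leibniz rule turns one product into a sum of two, so products alone do not form a class to
    which [smooth_coind] applies; closing them under sums does. *)
Inductive sum_of_products : ('rV[R]_n -> R) -> Prop :=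
| Product f g : smooth f -> smooth g -> sum_of_products (f * g)
| SumOfProducts f g : sum_of_products f -> sum_of_products g ->
    sum_of_products (f + g).

Let sop_derivable f : sum_of_products f -> forall i x, derivable f x (e i).
Proof.
elim=> [{}f g sf sg|{}f g _ df _ dg] i x.
  by apply: derivableM; exact: smooth_derivable.
by apply: derivableD.
Qed.

Let sop_smooth f : sum_of_products f -> smooth f.
Proof.
apply: smooth_coind => {}f.
- elim=> [{}f g sf sg x|{}f g _ cf _ cg x].
    by apply: continuousM; exact: smooth_continuous.
  by apply: continuousD; [exact: cf|exact: cg].
- exact: sop_derivable.
elim=> [{}f g sf sg i|{}f g sf cf sg cg i].
  rewrite (_ : partial i _ = f * partial i g + g * partial i f).
    have si := smooth_partial i sf; have sgi := smooth_partial i sg.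
    exact: SumOfProducts (Product sf sgi) (Product sg si).
  by apply/funext => x; rewrite /partial deriveM//; exact: smooth_derivable.
rewrite (_ : partial i _ = partial i f + partial i g).
  by apply: SumOfProducts; [exact: cf|exact: cg].
by apply/funext => x; rewrite /partial deriveD//; exact: sop_derivable.
Qed.

Lemma smoothM f g : smooth f -> smooth g -> smooth (f * g).
Proof. by move=> sf sg; apply: sop_smooth; exact: Product. Qed.

Lemma smoothD f g : smooth f -> smooth g -> smooth (f + g).
Proof.
move=> sf sg; apply: sop_smooth; rewrite -(mulr1 f) -(mulr1 g).
exact: SumOfProducts (Product sf (smooth_cst 1)) (Product sg (smooth_cst 1)).
Qed.

Lemma smooth_sum (I : Type) (s : seq I) (F : I -> 'rV[R]_n -> R) :
  (forall j, smooth (F j)) -> smooth (\sum_(j <- s) F j).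
Proof.
move=> sF; apply: (big_ind (@smooth R n) (smooth_cst 0) smoothD) => j _.
exact: sF.
Qed.

Lemma smooth_prod (I : Type) (s : seq I) (F : I -> 'rV[R]_n -> R) :
  (forall j, smooth (F j)) -> smooth (\prod_(j <- s) F j).
Proof.
move=> sF; apply: (big_ind (@smooth R n) (smooth_cst 1) smoothM) => j _.
exact: sF.
Qed.

(** The vector is assembled one coordinate at a time with [is_derive_add_dir], whose continuity
    requirement is met because the partial derivatives of a smooth function are continuous. *)
Lemma smooth_is_derive f x v : smooth f ->
  is_derive x v f (\sum_(i < n) v ord0 i * partial i f x).
Proof.
move=> sf; rewrite [v in is_derive _ v](row_sum_delta v).
elim: (index_enum _) x => [|i s ih] x.
  by rewrite !big_nil; exact: is_derive0.
have di y := @is_derive_scale_dir _ _ f y (e i) (v ord0 i) (smooth_derivable sf).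
have [ds Es] := ih x.
rewrite !big_cons -Es -[v ord0 i * _](@derive_val _ _ _ _ _ _ _ (di x)).
apply: is_derive_add_dir; [by move=> y; have [] := di y|by []|].
rewrite (_ : (fun y => _) = cst (v ord0 i) * partial i f).
  by move=> y; apply: continuousM; [exact: cst_continuous|
    apply: smooth_continuous; exact: smooth_partial].
by apply/funext => y; have [_ ->] := di y.
Qed.

Definition lincomb_partial v f : 'rV[R]_n -> R :=
  \sum_(i < n) cst (v ord0 i) * partial i f.

Lemma smooth_lincomb_partial v f : smooth f -> smooth (lincomb_partial v f).
Proof.
move=> sf; apply: smooth_sum => i; apply: smoothM; first exact: smooth_cst.
exact: smooth_partial.
Qed.

Lemma lincomb_partialE v f x :
  lincomb_partial v f x = \sum_(i < n) v ord0 i * partial i f x.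
Proof. by rewrite /lincomb_partial fct_sumE. Qed.

End smooth_functions.

(** * Test functions *)

Section test_functions.
Variables (R : realType) (n : nat).
Implicit Types (f g phi : 'rV[R]_n -> R) (x v : 'rV[R]_n) (i : 'I_n).
Local Notation e i := (delta_mx ord0 i : 'rV[R]_n).
Local Notation mu := (@lebesgue_rV R n).

Section composition_with_similarity.
Variables (r : R) (Q : 'M[R]_n) (b : 'rV[R]_n).

Let similarity_line i x (h : R) :
  similarity r Q b (h *: e i + x) = h *: (r *: row i Q) + similarity r Q b x.
Proof.
rewrite /similarity mulmxDl -scalemxAl -rowE scalerDr addrA.
by rewrite !scalerA mulrC.
Qed.

Lemma partial_similarity f i : smooth f ->
  partial i (f \o similarity r Q b) =
  lincomb_partial (r *: row i Q) f \o similarity r Q b.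
Proof.
move=> sf; apply/funext => x; rewrite /partial /= lincomb_partialE.
have [_ ->] := derive_affine_comp f (similarity_line i x).
by have [_ ->] := smooth_is_derive (similarity r Q b x) (r *: row i Q) sf.
Qed.

Lemma smooth_similarity f : smooth f -> smooth (f \o similarity r Q b).
Proof.
move=> sf; apply: (@smooth_coind _ _
    (fun g => exists2 h, smooth h & g = h \o similarity r Q b)); last by exists f.
- move=> _ [h sh ->] x; apply: continuous_comp; first exact: continuous_similarity.
  exact: smooth_continuous.
- move=> _ [h sh ->] i x; have [-> _] := derive_affine_comp h (similarity_line i x).
  by have [] := smooth_is_derive (similarity r Q b x) (r *: row i Q) sh.
move=> _ [h sh ->] i; exists (lincomb_partial (r *: row i Q) h).
  exact: smooth_lincomb_partial.
exact: partial_similarity.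
Qed.

End composition_with_similarity.

Lemma similarityK r (Q : 'M[R]_n) b : r != 0 -> Q *m Q^T = 1%:M ->
  cancel (similarity r Q b) (similarity r^-1 Q^T (- (r^-1 *: (b *m Q^T)))).
Proof.
move=> r0 QQ1 x; rewrite /similarity mulmxDl scalerDr addrK -scalemxAl scalerA.
by rewrite mulVf// scale1r -mulmxA QQ1 mulmx1.
Qed.

Lemma test_function_of_support phi (K : set 'rV[R]_n) : smooth phi -> compact K ->
  (forall x, phi x != 0 -> K x) -> test_function phi.
Proof.
move=> sphi cK phiK; split=> //; apply: (subclosed_compact _ cK).
  exact: closed_closure.
have /closure_id -> : closed K by exact: compact_closed.
by apply: closure_subset => x; exact: phiK.
Qed.

Lemma test_function_similarity r (Q : 'M[R]_n) b phi : r != 0 -> Q *m Q^T = 1%:M ->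
  test_function phi -> test_function (phi \o similarity r Q b).
Proof.
move=> r0 QQ1 [sphi cphi].
pose S := similarity r^-1 Q^T (- (r^-1 *: (b *m Q^T))).
apply: (@test_function_of_support _ (S @` closure [set x | phi x != 0])).
- exact: smooth_similarity.
- apply: continuous_compact => //; apply: continuous_subspaceT.
  exact: continuous_similarity.
move=> x /= phix; exists (similarity r Q b x); last exact: similarityK.
exact: subset_closure.
Qed.

Lemma partial_support phi i x : partial i phi x != 0 ->
  closure [set y | phi y != 0] x.
Proof.
apply: contra_neqP => ncx.
have : \forall y \near x, phi y = 0.
  have : nbhs x (~` closure [set y | phi y != 0]).
    apply: open_nbhs_nbhs; split=> //; apply: closed_openC; exact: closed_closure.
  apply: filterS => y ncy; apply/eqP; apply: contra_notT ncy => phiy.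
  exact: subset_closure.
move=> near0; rewrite /partial (near_eq_derive (g := cst 0)) ?derive_cst//.
Qed.

Lemma integrable_locally_integrableM f psi (K : set 'rV[R]_n) :
  locally_integrable_rV f -> continuous psi -> compact K ->
  (forall x, psi x != 0 -> K x) ->
  mu.-integrable setT (fun x => (f x * psi x)%:E).
Proof.
move=> [mf If] cpsi cK psiK.
have [C C0 hC] : exists2 C : R, 0 <= C & forall x, `|psi x| <= C.
  have : compact (psi @` K).
    by apply: continuous_compact => //; exact: continuous_subspaceT.
  move=> /compact_bounded[M [_ hM]].
  exists (`|M| + 1) => [|x]; first exact: addr_ge0.
  have [->|/psiK Kx] := eqVneq (psi x) 0; first by rewrite normr0 addr_ge0.
  apply: (hM (`|M| + 1)); last by exists x.
  by rewrite (le_lt_trans (ler_norm _))// ltrDl.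
have mK := compact_measurable_rV cK.
apply/integrableP; split.
  by apply/measurable_EFinP; apply: measurable_funM => //; exact: continuous_measurable_rV.
have {}If := If _ cK.
apply: (@le_lt_trans _ _ (\int[mu]_(x in K) (C%:E * `|f x|%:E))%E).
  rewrite [leRHS]integral_mkcond; apply: ge0_le_integral => //.
  - apply/measurable_EFinP; apply: measurableT_comp => //.
    by apply: measurable_funM => //; exact: continuous_measurable_rV.
  - apply/measurable_restrict => //; rewrite setTI.
    apply/measurable_EFinP; apply: measurable_funM => //.
    by apply: measurableT_comp => //; apply: measurable_funTS.
  move=> x _; rewrite patchE; case: ifPn => [_|/negP Kx].
    by rewrite -EFinM lee_fin normrM mulrC ler_wpM2r.
  have -> : psi x = 0 by apply/eqP/negP => /negP /psiK Kx'; apply: Kx; rewrite inE.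
  by rewrite mulr0 abse0.
rewrite ge0_integralZl_EFin//; last first.
  by apply/measurable_EFinP/measurableT_comp => //; exact: measurable_funTS.
by rewrite lte_mul_pinfty// lee_fin.
Qed.

End test_functions.

(** * Bump functions *)

Section flat_functions.
Variable R : realType.
Implicit Types (p : {poly R}) (t : R).

(* The functions [p(1/t) exp(-1/t)], extended by 0 to [t <= 0], form a class
   closed under differentiation. *)
Definition flat p t : R := if 0 < t then p.[t^-1] * expR (- t^-1) else 0.

Lemma flat_le0 p t : t <= 0 -> flat p t = 0.
Proof. by rewrite /flat ltNge => ->. Qed.

(** With [s = 1/t], the exponential series gives [s ^ i.+1 / (i.+1)! <= exp s]. Using one power more
    than the monomial [s ^ i] leaves the factor [t], which yields differentiability at the
    origin. *)
Lemma flat_linear_bound p : exists2 C : R, 0 <= C & forall t, `|flat p t| <= C * `|t|.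
Proof.
exists (\sum_(i < size p) `|p`_i| * (i.+1)`!%:R) => [|t].
  by apply: sumr_ge0 => i _; rewrite mulr_ge0.
rewrite /flat; case: ifPn => [t0|_]; last first.
  by rewrite normr0 mulr_ge0//; apply: sumr_ge0 => i _; rewrite mulr_ge0.
rewrite horner_coef !mulr_suml; apply: le_trans (ler_norm_sum _ _ _) _.
apply: ler_sum => i _; rewrite !normrM -!mulrA ler_wpM2l//.
have s0 : 0 < t^-1 by rewrite invr_gt0.
rewrite normrX !gtr0_norm ?expR_gt0// expRN ler_pdivrMr ?expR_gt0//.
have F0 : 0 < (i.+1)`!%:R :> R by rewrite ltr0n fact_gt0.
have -> : t^-1 ^+ i = (i.+1)`!%:R * t * (t^-1 ^+ i.+1 / (i.+1)`!%:R).
  by rewrite exprS; field; rewrite !gt_eqF.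
apply: ler_wpM2l; first by rewrite mulr_ge0// ltW.
apply: le_trans (expR_ge1Dxn i (ltW s0)); by rewrite lerDr.
Qed.

(** For [t > 0] put [s = 1/t]: the derivative of [p(s) exp(-s)] in [s] is [(p' - p)(s) exp(-s)], and
    [ds/dt = - s^2]. At 0 the difference quotient of [flat p] is [flat ('X * p)], which tends to 0
    by the linear bound. *)
Lemma is_derive_flat p t : is_derive t 1 (flat p) (flat ('X^2 * (p - p^`())) t).
Proof.
have [t0|t0|->] := ltgtP t 0.
- rewrite flat_le0 ?ltW//; apply: (@near_eq_is_derive _ _ _ (cst 0)).
  by near=> s; rewrite flat_le0// ltW//; near: s; exact: lt_nbhsl.
- pose H := (horner p * (expR \o -%R)) : R -> R.
  apply: (@near_eq_is_derive _ _ _ (H \o (fun s => s^-1))).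
    by near=> s; rewrite /flat ifT//; near: s; exact: lt_nbhsr.
  have dV : is_derive t 1 (fun s : R => s^-1) (- t ^- 2 *: 1).
    by apply: (@is_deriveV R id) => //; rewrite gt_eqF.
  have dE : is_derive (t^-1) 1 (expR \o -%R) (expR (- t^-1) * - 1).
    exact: is_derive1_comp.
  have dH := is_deriveM (is_derive_poly p t^-1) dE.
  have [dC1 dC2] := @is_derive1_comp R H (fun s : R => s^-1) t _ _ dH dV.
  split; [exact: dC1|rewrite dC2].
  rewrite /flat t0 /= hornerM hornerXn hornerD hornerN [_ *: 1]mulr1.
  by rewrite /GRing.scale /= exprVn; ring.
have [C C0 hC] := flat_linear_bound ('X * p).
have E (h : R) : h^-1 *: ((flat p \o shift 0) (h *: 1) - flat p 0) = flat ('X * p) h.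
  rewrite /= addr0 [h *: _]mulr1 (@flat_le0 _ 0)// subr0 /flat; case: ifPn => _.
    by rewrite hornerM hornerX [LHS]mulrA.
  by rewrite scaler0.
rewrite (flat_le0 _ (lexx 0)).
suff lim0 : (fun h : R => h^-1 *: ((flat p \o shift 0) (h *: 1) - flat p 0)) @ 0^' --> (0 : R).
  by split; [apply/cvg_ex; exists 0|exact/cvg_lim].
under eq_cvg do rewrite E.
apply/cvgr0Pnorm_lt => d d0; near=> h; apply: le_lt_trans (hC h) _.
apply: (@le_lt_trans _ _ ((C + 1) * `|h|)); first by rewrite ler_wpM2r// lerDl.
rewrite mulrC -ltr_pdivlMr ?ltr_wpDl//.
by near: h; apply: dnbhs0_lt; rewrite divr_gt0// ltr_wpDl.
Unshelve. all: by end_near. Qed.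

Lemma flat1_ge0 t : 0 <= flat 1 t.
Proof. by rewrite /flat; case: ifP => // _; rewrite hornerC mul1r expR_ge0. Qed.

Lemma flat1_le1 t : flat 1 t <= 1.
Proof.
rewrite /flat; case: ifPn => // t0; rewrite hornerC mul1r expR_le1.
by rewrite oppr_le0 invr_ge0 ltW.
Qed.

Lemma flat1_cvg t : 0 < t -> flat 1 (k.+1%:R * t) @[k --> \oo] --> (1 : R).
Proof.
move=> t0.
have -> : (fun k : nat => flat 1 (k.+1%:R * t)) =
    (fun k : nat => expR (- t^-1 * harmonic k)).
  apply/funext => k; rewrite /flat mulr_gt0 ?ltr0n// hornerC mul1r.
  by rewrite /harmonic /= invfM mulrC mulNr.
have -> : (1 : R) = expR (- t^-1 * 0) by rewrite mulr0 expR0.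
apply: continuous_cvg; first exact: continuous_expR.
by apply: cvgM; [exact: cvg_cst|exact: cvg_harmonic].
Qed.

End flat_functions.

Section bumps.
Variables (R : realType) (n : nat).
Implicit Types (a b x : 'rV[R]_n) (i : 'I_n).

(** The functions [flat q \o l], with [l] the affine form in the argument, are closed under partial
    derivatives: the inner derivative, [al] or 0, is a constant that the polynomial absorbs. *)
Lemma smooth_flat p (al be : R) i :
  smooth (fun x : 'rV[R]_n => flat p (al * x ord0 i + be)).
Proof.
pose l (x : 'rV[R]_n) : R := al * x ord0 i + be.
have hl j x (h : R) : l (h *: delta_mx ord0 j + x) =
    h *: ((al * (i == j)%:R) *: (1 : R^o)) + l x.
  by rewrite /l !mxE eqxx /= addrA mulrDr [_ *: 1]mulr1 [h *: _]/(_ * _) mulrCA.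
have dl q j x : is_derive (l x : R^o) ((al * (i == j)%:R) *: (1 : R^o)) (flat q)
    (al * (i == j)%:R * flat ('X^2 * (q - q^`())) (l x)).
  have [dq Eq] := is_derive_flat q (l x).
  by rewrite -Eq; exact: is_derive_scale_dir.
apply: (@smooth_coind _ _ (fun f => exists q, f = flat q \o l)); last by exists p.
- move=> _ [q ->] x.
  apply: (@continuous_comp _ _ _ l (flat q)).
    apply: (@continuousD _ R^o _ (fun y : 'rV[R]_n => al * y ord0 i) (cst be)).
      apply: (@continuousM _ _ (cst al) (fun y : 'rV[R]_n => y ord0 i)).
        exact: cst_continuous.
      exact: coord_continuous.
    exact: cst_continuous.
  apply: differentiable_continuous; apply/derivable1_diffP.
  by have [] := is_derive_flat q (l x).
- move=> _ [q ->] j x; have [-> _] := derive_affine_comp (flat q : R^o -> R) (hl j x).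
  by have [] := dl q j x.
move=> _ [q ->] j; exists ((al * (i == j)%:R) *: ('X^2 * (q - q^`()))).
apply/funext => x; rewrite /partial.
have [_ ->] := derive_affine_comp (flat q : R^o -> R) (hl j x).
have [_ ->] := dl q j x; rewrite /= /flat; case: ifP => _; last by rewrite mulr0.
by rewrite hornerZ mulrA.
Qed.

End bumps.

(** * The fundamental lemma of the calculus of variations *)

Section fundamental_lemma.
Variables (R : realType) (n : nat).
Implicit Types (a b x : 'rV[R]_n) (i : 'I_n) (g phi : 'rV[R]_n -> R).
Local Notation mu := (@lebesgue_rV R n).

(* As [k] grows, [flat 1 (k s) = exp(-1/(k s))] increases to the indicator of
   [s > 0], so these bumps increase to the indicator of the box. *)
Definition obox_bump a b (k : nat) : 'rV[R]_n -> R :=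
  \prod_(i < n) ((fun x => flat 1 (k.+1%:R * x ord0 i + k.+1%:R * - a ord0 i)) *
                 (fun x => flat 1 (- k.+1%:R * x ord0 i + k.+1%:R * b ord0 i))).

Lemma obox_bumpE a b k x : obox_bump a b k x = \prod_(i < n)
  (flat 1 (k.+1%:R * (x ord0 i - a ord0 i)) * flat 1 (k.+1%:R * (b ord0 i - x ord0 i))).
Proof.
rewrite /obox_bump fct_prodE; apply: eq_bigr => i _ /=.
by congr (flat 1 _ * flat 1 _); ring.
Qed.

Lemma obox_bump_ge0 a b k x : 0 <= obox_bump a b k x.
Proof. by rewrite obox_bumpE; apply: prodr_ge0 => i _; rewrite mulr_ge0// flat1_ge0. Qed.

Lemma obox_bump_le1 a b k x : obox_bump a b k x <= 1.
Proof.
rewrite obox_bumpE; apply: prodr_ile1 => i _.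
by rewrite mulr_ge0 ?flat1_ge0//= mulr_ile1// ?flat1_ge0// flat1_le1.
Qed.

Lemma obox_bump_neq0 a b k x : obox_bump a b k x != 0 -> obox a b x.
Proof.
rewrite obox_bumpE => /prodf_neq0 h i; have := h i isT.
rewrite mulf_eq0 negb_or => /andP[h1 h2].
rewrite -[a _ _ < _]subr_gt0 -[_ < b _ _]subr_gt0.
rewrite -(@pmulr_rgt0 _ k.+1%:R)// -[X in _ && X](@pmulr_rgt0 _ k.+1%:R)//.
by apply/andP; split; rewrite ltNge; [apply: contra h1|apply: contra h2] => /flat_le0 ->.
Qed.

Definition cbox a b : set 'rV[R]_n :=
  [set x | forall i, `[a ord0 i, b ord0 i]%classic (x ord0 i)].

Lemma compact_cbox a b : compact (cbox a b).
Proof.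
apply: (@rV_compact R n (fun i => `[a ord0 i, b ord0 i]%classic)) => i.
exact: segment_compact.
Qed.

Lemma obox_sub_cbox a b : obox a b `<=` cbox a b.
Proof. by move=> x hx i; have /andP[? ?] := hx i; rewrite /= in_itv /= !ltW. Qed.

Lemma test_function_obox_bump a b k : test_function (obox_bump a b k).
Proof.
apply: (@test_function_of_support _ _ _ (cbox a b)).
- by apply: smooth_prod => i; apply: smoothM; exact: smooth_flat.
- exact: compact_cbox.
by move=> x /obox_bump_neq0; exact: obox_sub_cbox.
Qed.

Lemma obox_bump_cvg a b x : obox a b x -> obox_bump a b k x @[k --> \oo] --> (1 : R).
Proof.
move=> hx; under eq_cvg do rewrite obox_bumpE.
have E : \prod_(i < n) (1 : R) = 1 by rewrite big1.
suff : (fun k : nat => \prod_(i < n) (flat 1 (k.+1%:R * (x ord0 i - a ord0 i)) *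
    flat 1 (k.+1%:R * (b ord0 i - x ord0 i)))) @ \oo --> \prod_(i < n) (1 : R).
  by rewrite E.
apply: (@cvg_big R 'I_n *%R 1 predT (@mul_continuous R)) => i _.
have /andP[ax xb] := hx i.
have := cvgM (@flat1_cvg R (x ord0 i - a ord0 i) _) (@flat1_cvg R (b ord0 i - x ord0 i) _).
by rewrite !subr_gt0 mulr1; exact.
Qed.

Lemma locally_integrable_obox g a b : locally_integrable_rV g ->
  mu.-integrable (obox a b) (EFin \o g).
Proof.
move=> [mg ig]; apply: (@integrableS _ _ _ _ (cbox a b)).
- by apply: compact_measurable_rV; exact: compact_cbox.
- exact: measurable_obox.
- exact: obox_sub_cbox.
apply/integrableP; split; last by apply: ig; exact: compact_cbox.
by apply/measurable_EFinP; exact: measurable_funTS.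
Qed.

(** The bumps vanish off the box, are bounded by 1 and tend to 1 on it, so dominated convergence
    with majorant [|g|] carries the vanishing integrals to the box. *)
Lemma integral_obox_eq0 g a b : locally_integrable_rV g ->
  (forall phi, test_function phi -> \int[mu]_x (g x * phi x)%:E = 0)%E ->
  (\int[mu]_(x in obox a b) (g x)%:E = 0)%E.
Proof.
move=> lg hg; have [mg _] := lg.
have mb k : measurable_fun setT (obox_bump a b k).
  apply: continuous_measurable_rV; apply: smooth_continuous.
  by have [] := test_function_obox_bump a b k.
have [] := @dominated_convergence _ _ _ mu (obox a b) (measurable_obox a b)
  (fun k x => (g x * obox_bump a b k x)%:E) (EFin \o g) (fun x => `|g x|%:E).
- move=> k; apply/measurable_EFinP; apply: measurable_funTS.
  exact: measurable_funM.
- by apply/measurable_EFinP; exact: measurable_funTS.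
- apply: aeW => x hx; apply: cvg_EFin; first exact: nearW.
  by have := cvgM (cvg_cst (g x)) (obox_bump_cvg hx); rewrite mulr1; exact.
- by apply: (@integrable_abse _ _ _ mu _ (EFin \o g)); exact: locally_integrable_obox.
- apply: aeW => x k _; rewrite /= lee_fin normrM ler_piMr//.
  by rewrite ger0_norm ?obox_bump_le1// obox_bump_ge0.
move=> _ _; set F := (X in X @ _ --> _) => cF.
have F0 k : F k = 0%E.
  rewrite /F /= -[RHS](hg _ (test_function_obox_bump a b k)).
  rewrite integral_mkcond; apply: eq_integral => x _; rewrite patchE.
  case: ifPn => // /negP xab; have [->|/obox_bump_neq0] := eqVneq (obox_bump a b k x) 0.
    by rewrite mulr0.
  by move=> hx; exfalso; apply: xab; rewrite inE.
have -> : (\int[mu]_(x in obox a b) (g x)%:E = lim (F @ \oo))%E by apply/esym/cvg_lim.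
by rewrite (_ : F = cst 0%E) ?lim_cst//; apply/funext => k; exact: F0.
Qed.

(** Inside a fixed cube [D], the sets [E] with zero integral of [g] over [E] and [D] in common form
    a Dynkin system; it contains the boxes, hence every measurable set. So [g] vanishes almost
    everywhere in each cube, and countably many cubes cover the space. *)
Lemma test_functions_separate g : locally_integrable_rV g ->
  (forall phi, test_function phi -> \int[mu]_x (g x * phi x)%:E = 0)%E ->
  {ae mu, forall x, g x = 0}.
Proof.
move=> lg hg; have [mg _] := lg.
have gk k : ae_eq mu (@obox_cube R n k) (EFin \o g) (cst 0%E).
  set D := obox_cube k; have mD : measurable D by exact: measurable_obox.
  have iD : mu.-integrable D (EFin \o g) by exact: locally_integrable_obox.
  apply: integral_ae_eq => // E ED mE.
  rewrite integral0 -(setIidl ED).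
  move: E mE {ED} => E; rewrite measurable_rVE => mE.
  apply: (dynkin_induction (P := fun E => (\int[mu]_(x in E `&` D) (EFin \o g) x = 0)%E)
    (@measurable_rVE R n) (@oboxes_setI R n) _ _ _ _ mE).
  - by rewrite setTI; exact: integral_obox_eq0.
  - move=> _ [[a b] _ <-] /=.
    have [[c d] _ <-] : @oboxes R n (obox a b `&` D).
      apply: oboxes_setI; first by exists (a, b).
      by exists (const_mx (- k%:R), const_mx k%:R).
    exact: integral_obox_eq0.
  - move=> S mS S0.
    have : (\int[mu]_(x in D) (EFin \o g) x = 0)%E by exact: integral_obox_eq0.
    have {1}-> : D = (S `&` D) `|` (~` S `&` D) by rewrite -setIUl setUv setTI.
    rewrite integral_setU.
    - by rewrite S0 add0e.
    - exact: measurableI.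
    - by apply: measurableI => //; exact: measurableC.
    - by apply/measurable_EFinP; exact: measurable_funTS.
    - by apply/disj_setPS => x [[Sx _] [/(_ Sx)]].
  move=> F mF tF F0; rewrite setI_bigcupl integral_bigcup//.
  - by rewrite eseries0// => j _ _; exact: F0.
  - exact: trivIset_setIr.
  - by move=> j; apply: measurableI.
  apply: integrableS iD => //; last by move=> x [j _ []].
  by apply: bigcup_measurable => j _; exact: measurableI.
have : mu.-negligible (\bigcup_k ~` [set x | @obox_cube R n k x -> (g x)%:E = 0%E]).
  by apply: negligible_bigcup => k; exact: gk.
apply: negligibleS => x /= gx0.
have [k _ xk] : (\bigcup_k @obox_cube R n k) x by rewrite bigcup_obox_cube.
by exists k => //= /(_ xk) [].
Qed.

End fundamental_lemma.

(** * Weak partial derivatives *)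

Section weak_partials.
Variables (R : realType) (n : nat).
Implicit Types (x : 'rV[R]_n) (i : 'I_n) (u v f g h phi : 'rV[R]_n -> R).
Local Notation mu := (@lebesgue_rV R n).

Lemma locally_integrable_rVP f : locally_integrable_rV f <->
  measurable_fun setT f /\ forall K, compact K -> mu.-integrable K (EFin \o f).
Proof.
split=> -[mf If]; split=> // K cK; last by have /integrableP[] := If K cK.
apply/integrableP; split; last exact: If.
by apply/measurable_EFinP; exact: measurable_funTS.
Qed.

(** Linear combinations over an arbitrary list let one statement cover [a u + b v] (indexed by
    [bool]), [c u] (by [unit]) and the sums over coordinates in the chain rule. *)
Lemma locally_integrable_rV_lin (I : Type) (s : seq I) (c : I -> R)
    (f : I -> 'rV[R]_n -> R) : (forall j, locally_integrable_rV (f j)) ->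
  locally_integrable_rV (fun x => \sum_(j <- s) c j * f j x).
Proof.
move=> lf; elim: s => [|j s ih].
  rewrite (_ : (fun _ => _) = cst 0); last by apply/funext => x; rewrite big_nil.
  by split => // K cK; rewrite (eq_integral (cst 0%E)) ?integral0// => x _; rewrite normr0.
rewrite (_ : (fun _ => _) = fun x => c j * f j x + \sum_(j <- s) c j * f j x); last first.
  by apply/funext => x; rewrite big_cons.
have /locally_integrable_rVP[ms Is] := ih.
have /locally_integrable_rVP[mj Ij] := lf j.
apply/locally_integrable_rVP; split => [|K cK].
  by apply: measurable_funD => //; exact: measurable_funM.
have mK := compact_measurable_rV cK.
rewrite (_ : EFin \o _ = (fun x => (c j)%:E * (f j x)%:E)%E \+
    (fun x => (\sum_(j <- s) c j * f j x)%:E))%E//.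
apply: integrableD => //.
  exact: (integrableZl mK (c j) (Ij K cK)).
exact: Is.
Qed.

Lemma integral_lin (I : Type) (s : seq I) (c : I -> R) (f : I -> 'rV[R]_n -> R) :
  (forall j, mu.-integrable setT (EFin \o f j)) ->
  mu.-integrable setT (fun x => (\sum_(j <- s) c j * f j x)%:E) /\
  (\int[mu]_x (\sum_(j <- s) c j * f j x)%:E =
   \sum_(j <- s) (c j)%:E * \int[mu]_x (f j x)%:E)%E.
Proof.
move=> If; elim: s => [|j s [Is Es]].
  rewrite big_nil (_ : (fun _ => _) = cst 0%E); last by apply/funext => x; rewrite big_nil.
  by split; [exact: integrable0|rewrite integral0].
rewrite big_cons (_ : (fun _ => _) =
    fun x => (c j)%:E * (f j x)%:E + (\sum_(j <- s) c j * f j x)%:E)%E; last first.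
  by apply/funext => x; rewrite big_cons.
have Ij : mu.-integrable setT (fun x => (c j)%:E * (f j x)%:E)%E.
  exact: (integrableZl measurableT (c j) (If j)).
split; first exact: (integrableD measurableT Ij Is).
rewrite (integralD measurableT Ij Is).
by rewrite (integralZl measurableT (If j)) Es.
Qed.

Lemma integrable_test f phi : locally_integrable_rV f -> test_function phi ->
  mu.-integrable setT (fun x => (f x * phi x)%:E).
Proof.
move=> lf [sphi cphi]; apply: (integrable_locally_integrableM lf _ cphi).
  exact: smooth_continuous.
by move=> x phix; exact: subset_closure.
Qed.

Lemma integrable_test_partial f phi i : locally_integrable_rV f -> test_function phi ->
  mu.-integrable setT (fun x => (f x * partial i phi x)%:E).
Proof.
move=> lf [sphi cphi]; apply: (integrable_locally_integrableM lf _ cphi).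
  by apply: smooth_continuous; exact: smooth_partial.
by move=> x; exact: partial_support.
Qed.

Lemma is_weak_partial_lin (I : Type) (s : seq I) (c : I -> R)
    (f g : I -> 'rV[R]_n -> R) i :
  (forall j, locally_integrable_rV (f j)) ->
  (forall j, is_weak_partial i (f j) (g j)) ->
  is_weak_partial i (fun x => \sum_(j <- s) c j * f j x)
                    (fun x => \sum_(j <- s) c j * g j x).
Proof.
move=> lf wf; split.
  by apply: locally_integrable_rV_lin => j; have [] := wf j.
move=> phi tphi.
have If j := integrable_test_partial i (lf j) tphi.
have Ig j := integrable_test (proj1 (wf j)) tphi.
transitivity (\sum_(j <- s) (c j)%:E * \int[mu]_x (f j x * partial i phi x)%:E)%E.
  have [_ <-] := integral_lin s c If; apply: eq_integral => x _.
  by rewrite mulr_suml; congr EFin; apply: eq_bigr => j _; exact/esym/mulrA.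
transitivity (- \sum_(j <- s) (c j)%:E * \int[mu]_x (g j x * phi x)%:E)%E; last first.
  have [_ <-] := integral_lin s c Ig; congr (- _)%E; apply: eq_integral => x _.
  by rewrite mulr_suml; congr EFin; apply: eq_bigr => j _; exact/mulrA.
(* Opposites distribute over this sum of extended reals because each term is finite. *)
rewrite -fin_num_sumeN; last first.
  by move=> j _; rewrite fin_numM// integrable_fin_num.
by apply: eq_bigr => j _; rewrite -muleN; have [_ ->] := wf j.
Qed.

Lemma weak_partialP i u : (exists g, is_weak_partial i u g) ->
  is_weak_partial i u (weak_partial i u).
Proof.
move=> [g ug].
by apply: (@xgetPex _ (cst 0) [set g | is_weak_partial i u g]); exists g.
Qed.

(** Against every test function [g] and [h] have the same finite integral, namely minus that of [u]
    against the partial derivative, so [g - h] is annihilated by all test functions. *)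
Lemma is_weak_partial_unique i u g h : locally_integrable_rV u ->
  is_weak_partial i u g -> is_weak_partial i u h -> {ae mu, forall x, g x = h x}.
Proof.
move=> lu [lg ug] [lh uh].
have lgh : locally_integrable_rV (fun x => g x - h x).
  have := @locally_integrable_rV_lin bool [:: true; false]
    (fun b => if b then 1 else - 1) (fun b => if b then g else h).
  rewrite (_ : (fun x => \sum_(j <- _) _) = (fun x => g x - h x)).
    by apply; case.
  by apply/funext => x; rewrite !big_cons big_nil mul1r mulN1r addr0.
suff : {ae mu, forall x, g x - h x = 0}.
  by apply: filterS => x /eqP; rewrite subr_eq0 => /eqP.
apply: test_functions_separate => // phi tphi.
under eq_integral do rewrite mulrBl EFinB.
rewrite (@integralB_EFin _ _ _ mu setT (fun x => g x * phi x) (fun x => h x * phi x))//;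
  [|exact: integrable_test|exact: integrable_test].
rewrite -[X in (X - _)%E]oppeK -ug// -[X in (_ - X)%E]oppeK -uh// subee//.
by rewrite fin_numN; apply: integrable_fin_num => //; exact: integrable_test_partial.
Qed.

Section composition_with_similarity.
Variables (r : R) (Q : 'M[R]_n) (b : 'rV[R]_n).
Hypotheses (r0 : 0 < r) (QQ1 : Q *m Q^T = 1%:M).
Local Notation T := (similarity r Q b).

Lemma locally_integrable_similarity f : locally_integrable_rV f ->
  locally_integrable_rV (f \o T).
Proof.
move=> [mf If]; split=> [|K cK].
  by apply: measurableT_comp => //; exact: measurable_similarity.
have cTK : compact (T @` K).
  by apply: continuous_compact => //; apply: continuous_subspaceT; exact: continuous_similarity.
have mTK := compact_measurable_rV cTK.
rewrite integral_mkcond (_ : _ \_ _ =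
    fun x => ((fun y => `|f y|%:E) \_ (T @` K)) (T x)); last first.
  apply/funext => x; rewrite !patchE; congr (if _ then _ else _).
  apply/idP/idP; rewrite !inE; first by move=> Kx; exists x.
  move=> [y Ky /(congr1 (similarity r^-1 Q^T (- (r^-1 *: (b *m Q^T)))))].
  by rewrite !similarityK ?gt_eqF// => <-.
rewrite ge0_integral_similarity//; last 2 first.
- apply/(measurable_restrictT _ mTK)/measurable_EFinP.
  by apply: measurableT_comp => //; exact: measurable_funTS.
- by move=> x; rewrite patchE; case: ifP.
rewrite -integral_mkcond lte_mul_pinfty// ?lee_fin ?exprn_ge0// ?invr_ge0 ?ltW//.
exact: If.
Qed.

(** The chain rule is moved onto the test function: [phi = psi \o T] with [psi] the composite of
    [phi] with the inverse of [T], which is again a test function. Both sides then become integrals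
    of functions of [T x], and the common Jacobian factor drops out. *)
Lemma is_weak_partial_similarity v (g : 'I_n -> 'rV[R]_n -> R) i :
  locally_integrable_rV v -> (forall j, is_weak_partial j v (g j)) ->
  is_weak_partial i (v \o T) (fun x => \sum_(j < n) (r * Q i j) * g j (T x)).
Proof.
move=> lv vg.
have lG : locally_integrable_rV (fun y => \sum_(j < n) (r * Q i j) * g j y).
  by apply: locally_integrable_rV_lin => j; have [] := vg j.
split; first exact: (locally_integrable_similarity lG).
move=> phi tphi.
pose psi := phi \o similarity r^-1 Q^T (- (r^-1 *: (b *m Q^T))).
have QTQ1 : Q^T *m Q^T^T = 1%:M by rewrite trmxK; exact: mulmx1C.
have tpsi : test_function psi.
  by apply: test_function_similarity => //; rewrite invr_eq0 gt_eqF.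
have phiE x : phi x = psi (T x) by rewrite /psi /= similarityK// gt_eqF.
have [spsi _] := tpsi; have [mv _] := lv.
have dphiE x : partial i phi x = \sum_(j < n) (r * Q i j) * partial j psi (T x).
  have -> : phi = psi \o T by apply/funext.
  rewrite partial_similarity//= lincomb_partialE.
  by apply: eq_bigr => j _; rewrite !mxE.
have Iv j := integrable_test_partial j lv tpsi.
have Ig j := integrable_test (proj1 (vg j)) tpsi.
have [I1 E1] := integral_lin (index_enum 'I_n) (fun j => r * Q i j) Iv.
have [I2 E2] := integral_lin (index_enum 'I_n) (fun j => r * Q i j) Ig.
pose F1 y := (\sum_(j < n) (r * Q i j) * (v y * partial j psi y))%:E.
pose F2 y := (\sum_(j < n) (r * Q i j) * (g j y * psi y))%:E.
transitivity (\int[mu]_x F1 (T x))%E.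
  apply: eq_integral => x _; rewrite /F1 /= dphiE mulr_sumr; congr EFin.
  by apply: eq_bigr => j _; rewrite mulrCA.
rewrite (integral_similarity b r0 QQ1); last exact: measurable_int I1.
rewrite [X in (_ * X)%E]E1.
transitivity (- \int[mu]_x F2 (T x))%E; last first.
  congr (- _)%E; apply: eq_integral => x _; rewrite /F2 /= phiE mulr_suml; congr EFin.
  by apply: eq_bigr => j _; rewrite mulrA.
rewrite (integral_similarity b r0 QQ1); last exact: measurable_int I2.
rewrite [X in (- (_ * X))%E]E2 -muleN; congr (_ * _)%E.
rewrite -fin_num_sumeN; last by move=> j _; rewrite fin_numM// integrable_fin_num.
by apply: eq_bigr => j _; rewrite -muleN; have [_ ->] := vg j.
Qed.

End composition_with_similarity.

End weak_partials.

(** * Strict convexity of the p-th power of the Euclidean norm *)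

Section strict_convexity.
Variables (R : realType) (p : R).
Hypothesis p1 : 1 < p.

Let p0 : 0 < p. Proof. exact: lt_trans p1. Qed.

(* For [x = exp y] this is the strict convexity of [exp] at
   [y = (1/p) (p y) + (1 - 1/p) 0], by comparison with the tangent at [y]. *)
Lemma strict_bernoulli (x : R) : 0 <= x -> x != 1 -> 1 + p * (x - 1) < x `^ p.
Proof.
rewrite le_eqVlt => /predU1P[<- _|x0 x1].
  by rewrite powR0 ?gt_eqF// sub0r mulrN1 subr_lt0.
have [y xy] := expR_total x0; subst x.
have y0 : y != 0 by apply: contra x1 => /eqP ->; rewrite expR0.
rewrite -expRM [y * p]mulrC.
have e0 : 0 < expR y by exact: expR_gt0.
have h1 : 1 + (p - 1) * y < expR ((p - 1) * y).
  by apply: expR_gt1Dx; rewrite mulf_neq0// subr_eq0 gt_eqF.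
have h2 : 1 - y < expR (- y) by apply: expR_gt1Dx; rewrite oppr_eq0.
have -> : expR (p * y) = expR y * expR ((p - 1) * y).
  by rewrite -expRD; congr expR; ring.
have h3 : expR y * expR (- y) = 1 by rewrite expRxMexpNx_1.
(* This bound is added to [p - 1] times [h4]: the terms in [y] cancel and leave
   [p * expR y < expR (p * y) + (p - 1)]. *)
have : expR y * (1 + (p - 1) * y) < expR y * expR ((p - 1) * y) by rewrite ltr_pM2l.
have h4 : expR y * (1 - y) < 1 by rewrite -[ltRHS]h3 ltr_pM2l.
have : (p - 1) * (expR y * (1 - y)) < (p - 1) * 1 by rewrite ltr_pM2l ?subr_gt0.
lra.
Qed.

(** Bernoulli's inequality is applied to [s / m] and [t / m], with [m] the midpoint; the linear
    terms cancel because the two ratios add up to 2. *)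
Lemma powR_midpoint_lt (s t : R) : 0 <= s -> 0 <= t -> s != t ->
  ((s + t) / 2) `^ p < (s `^ p + t `^ p) / 2.
Proof.
move=> s0 t0 st.
have [m mE] : exists m, m = (s + t) / 2 by exists ((s + t) / 2).
rewrite -mE; have sm : s != m.
  by apply: contra st => /eqP h; apply/eqP; move: mE; rewrite -h; clear; lra.
have tm : t != m.
  by apply: contra st => /eqP h; apply/eqP; move: mE; rewrite -h; clear; lra.
have m0 : 0 < m.
  rewrite mE divr_gt0// lt_neqAle addr_ge0// andbT eq_sym paddr_eq0//.
  by apply: contra st => /andP[/eqP-> /eqP->].
have bern x : 0 <= x -> x != m -> m `^ p * (1 + p * (x / m - 1)) < x `^ p.
  move=> x0 xm; have xE : x = m * (x / m) by rewrite mulrCA divff ?mulr1// gt_eqF.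
  have -> : x `^ p = m `^ p * (x / m) `^ p.
    by rewrite {1}xE (powRM _ (ltW m0) (divr_ge0 x0 (ltW m0))).
  rewrite ltr_pM2l ?powR_gt0//; apply: strict_bernoulli; first exact: divr_ge0 x0 (ltW m0).
  by apply: contra xm => /eqP /(canRL (divfK (lt0r_neq0 m0))); rewrite mul1r => ->.
have E : 1 + p * (s / m - 1) + (1 + p * (t / m - 1)) = 2.
  have -> : 1 + p * (s / m - 1) + (1 + p * (t / m - 1)) = 2 + p * ((s + t) / m - 2) by ring.
  have -> : s + t = 2 * m by rewrite mE mulrC divfK.
  by rewrite mulfK ?subrr ?mulr0 ?addr0// gt_eqF.
have := ltrD (bern s s0 sm) (bern t t0 tm).
by rewrite -mulrDr E -ltr_pdivlMr.
Qed.

Lemma powR_midpoint_le (s t : R) : 0 <= s -> 0 <= t ->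
  ((s + t) / 2) `^ p <= (s `^ p + t `^ p) / 2.
Proof.
have half (x : R) : (x + x) / 2 = x by field.
move=> s0 t0; have [->|st] := eqVneq s t; first by rewrite !half.
exact/ltW/powR_midpoint_lt.
Qed.

Section euclidean.
Variable n : nat.
Implicit Types a b : 'rV[R]_n.

Lemma dotpC a b : dotp a b = dotp b a.
Proof. by apply: eq_bigr => i _; rewrite mulrC. Qed.

Lemma dotpDl a b c : dotp (a + b) c = dotp a c + dotp b c.
Proof. by rewrite /dotp -big_split; apply: eq_bigr => i _; rewrite mxE mulrDl. Qed.

Lemma dotpZl (k : R) a b : dotp (k *: a) b = k * dotp a b.
Proof. by rewrite /dotp mulr_sumr; apply: eq_bigr => i _; rewrite mxE mulrA. Qed.

Lemma dotpDr a b c : dotp a (b + c) = dotp a b + dotp a c.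
Proof. by rewrite dotpC dotpDl !(dotpC a). Qed.

Lemma dotpZr (k : R) a b : dotp a (k *: b) = k * dotp a b.
Proof. by rewrite dotpC dotpZl dotpC. Qed.

Lemma dotp_eq0 a : dotp a a = 0 -> a = 0.
Proof.
move=> a0; apply/rowP => i; rewrite mxE; apply/eqP; rewrite -sqrf_eq0 eq_le sqr_ge0 andbT.
by rewrite -a0; exact: sqr_coord_le_dotp.
Qed.

Lemma enorm_ge0 a : 0 <= enorm a.
Proof. exact: sqrtr_ge0. Qed.

Lemma sqr_enorm a : enorm a ^+ 2 = dotp a a.
Proof. by rewrite sqr_sqrtr// dotp_ge0. Qed.

Lemma enorm_eq0 a : enorm a = 0 -> a = 0.
Proof. by move=> a0; apply: dotp_eq0; rewrite -sqr_enorm a0 expr0n. Qed.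

Lemma enorm0 : enorm (0 : 'rV[R]_n) = 0.
Proof. by rewrite /enorm /dotp big1 ?sqrtr0// => i _; rewrite mxE mul0r. Qed.

Lemma enormZ (k : R) a : enorm (k *: a) = `|k| * enorm a.
Proof. by rewrite /enorm dotpZl dotpZr mulrA -expr2 sqrtrM ?sqr_ge0// sqrtr_sqr. Qed.

Lemma cauchy_schwarz a b : dotp a b <= enorm a * enorm b.
Proof.
have [a0|a0] := eqVneq (enorm a) 0.
  by rewrite a0 mul0r (enorm_eq0 a0) /dotp big1// => i _; rewrite mxE mul0r.
have [b0|b0] := eqVneq (enorm b) 0.
  by rewrite b0 mulr0 (enorm_eq0 b0) /dotp big1// => i _; rewrite mxE mulr0.
have ab0 : 0 < enorm a * enorm b by rewrite mulr_gt0// lt_neqAle eq_sym enorm_ge0 ?a0 ?b0.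
(* The squared length of this vector is [2 |a| |b| (|a| |b| - a . b)]. *)
have := dotp_ge0 (enorm b *: a + (- enorm a) *: b).
rewrite dotpDl !dotpDr !dotpZl !dotpZr -!sqr_enorm (dotpC b a) => h.
rewrite -subr_ge0 -(@pmulr_rge0 _ (enorm a * enorm b))//; nra.
Qed.

Lemma sqr_enorm_midpoint a b :
  enorm (2^-1 *: (a + b)) ^+ 2 = (enorm a ^+ 2 + enorm b ^+ 2 + 2 * dotp a b) / 4.
Proof.
by rewrite !sqr_enorm dotpZl dotpZr dotpDl !dotpDr (dotpC b a); field.
Qed.

Lemma enorm_midpoint_le a b : enorm (2^-1 *: (a + b)) <= (enorm a + enorm b) / 2.
Proof.
rewrite -(@ler_pXn2r _ 2)// ?nnegrE ?enorm_ge0 ?divr_ge0 ?addr_ge0 ?enorm_ge0//.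
rewrite sqr_enorm_midpoint; have := cauchy_schwarz a b; nra.
Qed.

Lemma enorm_powR_midpoint_le a b :
  enorm (2^-1 *: (a + b)) `^ p <= (enorm a `^ p + enorm b `^ p) / 2.
Proof.
apply: le_trans (powR_midpoint_le (enorm_ge0 a) (enorm_ge0 b)).
apply: (ge0_ler_powR (ltW p0)); rewrite ?nnegrE ?enorm_ge0 ?divr_ge0 ?addr_ge0 ?enorm_ge0//.
exact: enorm_midpoint_le.
Qed.

(** Strictness is used twice. The strict convexity of the power forces [|a| = |b|]; the midpoint
    then has this length too, so expanding its square gives [a . b = |b|^2], and [|a - b|^2 = 0]. *)
Lemma enorm_powR_midpoint_eq a b :
  enorm (2^-1 *: (a + b)) `^ p = (enorm a `^ p + enorm b `^ p) / 2 -> a = b.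
Proof.
move=> E.
have mle : enorm (2^-1 *: (a + b)) `^ p <= ((enorm a + enorm b) / 2) `^ p.
  apply: (ge0_ler_powR (ltW p0)); rewrite ?nnegrE ?enorm_ge0 ?divr_ge0 ?addr_ge0 ?enorm_ge0//.
  exact: enorm_midpoint_le.
have ab : enorm a = enorm b.
  apply/eqP/negP => /negP ab.
  by have := powR_midpoint_lt (enorm_ge0 a) (enorm_ge0 b) ab; rewrite -E ltNge mle.
have m : enorm (2^-1 *: (a + b)) = enorm b.
  apply: (powR_injective p0); rewrite ?nnegrE ?enorm_ge0// E ab.
  by field.
have := sqr_enorm_midpoint a b; rewrite m ab => h.
apply/eqP; rewrite -subr_eq0; apply/eqP/dotp_eq0.
have -> : a - b = a + (-1) *: b by rewrite scaleN1r.
rewrite dotpDl !dotpDr !dotpZl !dotpZr (dotpC b a) -!sqr_enorm ab; lra.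
Qed.

Lemma enorm_mulmx (Q : 'M[R]_n) a : Q *m Q^T = 1%:M -> enorm (a *m Q) = enorm a.
Proof. by move=> QQ1; rewrite /enorm dotp_mulmx. Qed.

End euclidean.
End strict_convexity.

(** * The p-energy of weak gradients *)

Section dirichlet_energy.
Variables (R : realType) (n : nat) (p : R).
Hypothesis p1 : 1 < p.
Implicit Types (u v f g : 'rV[R]_n -> R) (G H : 'rV[R]_n -> 'rV[R]_n).
Local Notation mu := (@lebesgue_rV R n).

Let p0 : 0 < p. Proof. exact: lt_trans p1. Qed.

Let pN0 : p != 0. Proof. by rewrite gt_eqF. Qed.

Definition energy G : \bar R := (\int[mu]_x (enorm (G x) `^ p)%:E)%E.

Lemma energy_ge0 G : (0 <= energy G)%E.
Proof. by apply: integral_ge0 => x _; rewrite lee_fin powR_ge0. Qed.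

Lemma norm_DuE u : norm_Du p u = (energy (weak_grad u) `^ p^-1)%E.
Proof.
rewrite /norm_Du unlock /energy; congr (_ `^ _)%E; apply: eq_integral => x _.
by rewrite /= ger0_norm// enorm_ge0.
Qed.

Lemma energyE u : energy (weak_grad u) = (norm_Du p u `^ p)%E.
Proof. by rewrite norm_DuE -poweRrM mulVf// poweRe1 ?energy_ge0. Qed.

Lemma measurable_enorm_powR G : measurable_fun setT G ->
  measurable_fun setT (fun x => enorm (G x) `^ p).
Proof.
move=> mG; apply: (measurableT_comp (measurable_powR p)).
apply: measurableT_comp mG; apply: continuous_measurable_rV => x.
apply: (@continuous_comp _ _ _ (fun y : 'rV[R]_n => dotp y y) (@Num.sqrt R)).
  exact: continuous_dotp.
exact: sqrt_continuous.
Qed.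

Lemma ae_eq_energy G H : measurable_fun setT G -> measurable_fun setT H ->
  {ae mu, forall x, G x = H x} -> energy G = energy H.
Proof.
move=> mG mH GH; apply: ge0_ae_eq_integral => //.
- by apply/measurable_EFinP; exact: measurable_enorm_powR.
- by apply/measurable_EFinP; exact: measurable_enorm_powR.
- by move=> x _; rewrite lee_fin powR_ge0.
- by move=> x _; rewrite lee_fin powR_ge0.
by apply: filterS GH => x -> _.
Qed.

Lemma measurable_rV_lin (a b : R) G H : measurable_fun setT G -> measurable_fun setT H ->
  measurable_fun setT (fun x => a *: G x + b *: H x).
Proof.
move=> mG mH; apply: measurable_fun_rVP => i.
rewrite (_ : _ \o _ = fun x => a * G x ord0 i + b * H x ord0 i); last first.
  by apply/funext => x; rewrite /rV_coor /= !mxE.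
apply: measurable_funD; apply: measurable_funM => //.
  exact: (measurableT_comp (measurable_rV_coor i) mG).
exact: (measurableT_comp (measurable_rV_coor i) mH).
Qed.

(** The pointwise gap [f2 - f1] in the convexity inequality is nonnegative, and its integral is 0
    since both integrals equal the finite number [N]. It vanishes almost everywhere, where the
    equality case applies. *)
Lemma energy_strictly_convex G H (N : R) :
  measurable_fun setT G -> measurable_fun setT H ->
  energy G = N%:E -> energy H = N%:E ->
  (N%:E <= energy (fun x => 2^-1 *: (G x + H x)))%E ->
  {ae mu, forall x, G x = H x}.
Proof.
move=> mG mH EG EH EGH.
have mGH : measurable_fun setT (fun x => 2^-1 *: (G x + H x)).
  rewrite (_ : (fun _ => _) = fun x => 2^-1 *: G x + 2^-1 *: H x).
    exact: measurable_rV_lin.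
  by apply/funext => x; rewrite scalerDr.
pose f1 x := enorm (2^-1 *: (G x + H x)) `^ p.
pose f2 x := (enorm (G x) `^ p + enorm (H x) `^ p) / 2.
have f12 x : f1 x <= f2 x by exact: enorm_powR_midpoint_le.
have f1_ge0 x : 0 <= f1 x by exact: powR_ge0.
have mf1 : measurable_fun setT f1 by exact: measurable_enorm_powR.
have mf2 : measurable_fun setT f2.
  by apply: measurable_funM => //; apply: measurable_funD; exact: measurable_enorm_powR.
have If2 : (\int[mu]_x (f2 x)%:E = N%:E)%E.
  under eq_integral do rewrite /f2 mulrC EFinM EFinD.
  have mG' := measurable_enorm_powR mG; have mH' := measurable_enorm_powR mH.
  have ge0 G' x : (0 <= (enorm (G' x : 'rV[R]_n) `^ p)%:E)%E by rewrite lee_fin powR_ge0.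
  rewrite ge0_integralZl_EFin//.
  - rewrite ge0_integralD//; [|exact/measurable_EFinP|exact/measurable_EFinP].
    rewrite [X in (_ * (X + _))%E]EG [X in (_ * (_ + X))%E]EH -EFinD -EFinM.
    by congr EFin; field.
  - by move=> x _; rewrite adde_ge0.
  by apply: emeasurable_funD; exact/measurable_EFinP.
have If1 : (\int[mu]_x (f1 x)%:E <= N%:E)%E.
  rewrite -If2; apply: ge0_le_integral => //.
  - by move=> x _; rewrite lee_fin.
  - exact/measurable_EFinP.
  - exact/measurable_EFinP.
  by move=> x _; rewrite lee_fin.
have {}If1 : (\int[mu]_x (f1 x)%:E = N%:E)%E by apply/eqP; rewrite eq_le If1.
have int1 : mu.-integrable setT (EFin \o f1).
  apply/integrableP; split; first exact/measurable_EFinP.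
  under eq_integral do rewrite /= ger0_norm//.
  by rewrite If1 ltry.
have int2 : mu.-integrable setT (EFin \o f2).
  apply/integrableP; split; first exact/measurable_EFinP.
  under eq_integral do rewrite /= (ger0_norm (le_trans (f1_ge0 _) (f12 _))).
  by rewrite If2 ltry.
have /(ae_eq_integral_abs mu measurableT) : (\int[mu]_x `|(f2 x - f1 x)%:E| = 0)%E.
  under eq_integral do rewrite /= ger0_norm ?subr_ge0// EFinB.
  by rewrite (integralB_EFin measurableT int2 int1) If1 If2 subee.
have mB : measurable_fun setT (fun x => (f2 x - f1 x)%:E).
  by apply/measurable_EFinP; exact: measurable_funB.
move=> /(_ mB); apply: filterS => x /(_ I) [/eqP]; rewrite subr_eq0 => /eqP E.
by apply: (enorm_powR_midpoint_eq p1); rewrite -/(f1 x) -/(f2 x) E.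
Qed.

Lemma Lfun_lin (I : Type) (s : seq I) (c : I -> R) (f : I -> 'rV[R]_n -> R) :
  (forall j, f j \in Lfun mu p%:E) ->
  (fun x => \sum_(j <- s) c j * f j x) \in Lfun mu p%:E.
Proof.
have p1E : (1 <= p%:E)%E by rewrite lee_fin ltW.
have [L0 LD] := Lfun_submod_closed mu p1E.
move=> Lf; elim: s => [|j s ih].
  by rewrite (_ : (fun _ => _) = 0)//; apply/funext => x; rewrite big_nil.
rewrite (_ : (fun _ => _) = c j *: f j + (fun x => \sum_(j <- s) c j * f j x)).
  exact: LD.
by apply/funext => x; rewrite big_cons.
Qed.

Lemma LfunP_integral f : f \in Lfun mu p%:E <->
  measurable_fun setT f /\ (\int[mu]_x (`|f x| `^ p)%:E < +oo)%E.
Proof.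
have E : ('N[mu]_p%:E[EFin \o f] = (\int[mu]_x (`|f x| `^ p)%:E) `^ p^-1)%E by rewrite unlock.
split=> [/andP[]|[mf If]].
  rewrite inE => mf; rewrite inE /= /finite_norm E => h; split=> //.
  by apply: (lty_poweRy _ h); rewrite invr_neq0.
apply/andP; split; first by rewrite inE.
by rewrite inE /= /finite_norm E; exact: poweR_lty.
Qed.

Lemma ae_eq_Lfun f g : measurable_fun setT f -> {ae mu, forall x, f x = g x} ->
  g \in Lfun mu p%:E -> f \in Lfun mu p%:E.
Proof.
move=> mf fg /LfunP_integral[mg Ig]; apply/LfunP_integral; split; first exact: mf.
suff -> : (\int[mu]_x (`|f x| `^ p)%:E = \int[mu]_x (`|g x| `^ p)%:E)%E by [].
apply: ge0_ae_eq_integral => //.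
- apply/measurable_EFinP; apply: (measurableT_comp (measurable_powR p)).
  exact: measurableT_comp.
- apply/measurable_EFinP; apply: (measurableT_comp (measurable_powR p)).
  exact: measurableT_comp.
by apply: filterS fg => x -> _.
Qed.

(** The way around the choice in [weak_partial]: an explicit family of weak derivatives agrees with
    the chosen one almost everywhere, which transfers both integrability and the formula for the
    gradient. *)
Lemma D1p_of_weak_partials u (g : 'I_n -> 'rV[R]_n -> R) :
  continuous u -> locally_integrable_rV u ->
  (forall i, is_weak_partial i u (g i)) -> (forall i, g i \in Lfun mu p%:E) ->
  D1p p u /\ {ae mu, forall x, weak_grad u x = \row_i g i x}.
Proof.
move=> cu lu wg Lg.
have wP i : is_weak_partial i u (weak_partial i u) by apply: weak_partialP; exists (g i).
have aeg i : {ae mu, forall x, weak_partial i u x = g i x}.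
  exact: (is_weak_partial_unique lu (wP i) (wg i)).
split; first split => // i.
  split; first by exists (g i).
  by apply: ae_eq_Lfun (aeg i) (Lg i); have [[]] := wP i.
have : {ae mu, forall x i, weak_partial i u x = g i x}.
  exact: filter_forall.
by apply: filterS => x h; apply/rowP => i; rewrite !mxE.
Qed.

Lemma D1p_weak_partial u i : D1p p u -> is_weak_partial i u (weak_partial i u).
Proof. by move=> [_ _ /(_ i) [h _]]; exact: weak_partialP. Qed.

Lemma measurable_weak_grad u : D1p p u -> measurable_fun setT (weak_grad u).
Proof.
move=> Du; apply: measurable_fun_rVP => i.
rewrite (_ : _ \o _ = weak_partial i u); last by apply/funext => x; rewrite /rV_coor /= mxE.
by have [[]] := D1p_weak_partial i Du.
Qed.

Lemma D1p_lin u v (a b : R) : D1p p u -> D1p p v ->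
  D1p p (fun x => a * u x + b * v x) /\
  {ae mu, forall x, weak_grad (fun x => a * u x + b * v x) x =
    a *: weak_grad u x + b *: weak_grad v x}.
Proof.
move=> Du Dv; have [cu lu Lu] := Du; have [cv lv Lv] := Dv.
pose c (k : bool) := if k then a else b; pose w (k : bool) := if k then u else v.
have sumE f g : (fun x => \sum_(k <- [:: true; false]) c k * (if k then f else g) x) =
    (fun x => a * f x + b * g x).
  by apply/funext => x; rewrite !big_cons big_nil addr0.
have lw k : locally_integrable_rV (w k) by case: k.
have [||||Dw Ew] := @D1p_of_weak_partials (fun x => a * u x + b * v x)
  (fun i x => a * weak_partial i u x + b * weak_partial i v x).
- move=> x; apply: (@continuousD _ _ _ (fun x => a * u x) (fun x => b * v x)).
    apply: (@continuousM _ _ (cst a) u); [exact: cst_continuous|exact: cu].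
  by apply: (@continuousM _ _ (cst b) v); [exact: cst_continuous|exact: cv].
- by rewrite -sumE; exact: (locally_integrable_rV_lin _ c lw).
- move=> i; rewrite -!sumE.
  apply: (@is_weak_partial_lin _ _ _ _ c w
    (fun k => if k then weak_partial i u else weak_partial i v)) => // -[];
  exact: D1p_weak_partial.
- move=> i; rewrite -sumE.
  apply: (@Lfun_lin _ _ c (fun k => if k then weak_partial i u else weak_partial i v)).
  by case; [have [] := Lu i|have [] := Lv i].
split=> //; apply: filterS Ew => x ->.
by apply/rowP => i; rewrite !mxE.
Qed.

End dirichlet_energy.

(** * Similarity invariance of the p-energy *)

Section similarity_invariance.
Variables (R : realType) (n : nat) (p : R).
Hypothesis p1 : 1 < p.
Variables (r : R) (Q : 'M[R]_n) (b : 'rV[R]_n).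
Hypotheses (r0 : 0 < r) (QQ1 : Q *m Q^T = 1%:M).
Local Notation mu := (@lebesgue_rV R n).
Local Notation T := (similarity r Q b).

Let p0 : 0 < p. Proof. exact: lt_trans p1. Qed.

Lemma Lfun_similarity (f : 'rV[R]_n -> R) : f \in Lfun mu p%:E -> f \o T \in Lfun mu p%:E.
Proof.
move=> /(LfunP_integral p1)[mf If]; apply/(LfunP_integral p1); split.
  by apply: measurableT_comp => //; exact: measurable_similarity.
rewrite (ge0_integral_similarity b r0 QQ1 (f := fun x => (`|f x| `^ p)%:E)).
- by rewrite lte_mul_pinfty// lee_fin exprn_ge0// invr_ge0 ltW.
- apply/measurable_EFinP; apply: (measurableT_comp (measurable_powR p)).
  exact: measurableT_comp.
- by move=> x; rewrite lee_fin powR_ge0.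
Qed.

(** Points are row vectors acted on by [Q] from the right, so moving the coordinate [i] moves the
    image along row [i] of [Q]; the gradient is therefore multiplied by the transpose. *)
Lemma D1p_similarity (v : 'rV[R]_n -> R) (c : R) : D1p p v ->
  D1p p (fun x => c * v (T x)) /\
  {ae mu, forall x, weak_grad (fun x => c * v (T x)) x =
    (c * r) *: (weak_grad v (T x) *m Q^T)}.
Proof.
move=> Dv; have [cv lv Lv] := Dv.
have lvT := locally_integrable_similarity b r0 QQ1 lv.
have sumE f : (fun x => \sum_(k <- [:: tt]) c * f x) = (fun x : 'rV[R]_n => c * f x).
  by apply/funext => x; rewrite !big_cons big_nil addr0.
have wv j := D1p_weak_partial j Dv.
pose g i x := \sum_(j < n) (r * Q i j) * weak_partial j v (T x).
have wT i : is_weak_partial i (v \o T) (g i).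
  exact: (is_weak_partial_similarity b r0 QQ1 i lv wv).
have [||||Dw Ew] := @D1p_of_weak_partials R n p p1 (fun x => c * v (T x))
  (fun i x => c * g i x).
- move=> x; apply: (@continuousM _ _ (cst c) (v \o T)); first exact: cst_continuous.
  by apply: continuous_comp; [exact: continuous_similarity|exact: cv].
- rewrite -sumE.
  by apply: (@locally_integrable_rV_lin _ _ unit [:: tt] (fun=> c) (fun=> v \o T)) => _.
- move=> i; rewrite -!sumE.
  by apply: (@is_weak_partial_lin _ _ unit [:: tt] (fun=> c) (fun=> v \o T) (fun=> g i)) => _.
- move=> i; rewrite -sumE; apply: (Lfun_lin p1 [:: tt] (fun=> c) (f := fun=> g i)) => _.
  apply: (Lfun_lin p1 (index_enum 'I_n) (fun j => r * Q i j)
    (f := fun j => weak_partial j v \o T)) => j.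
  by apply: Lfun_similarity; have [] := Lv j.
split=> //; apply: filterS Ew => x ->; apply/rowP => i; rewrite !mxE /g -mulrA mulr_sumr.
congr (_ * _); apply: eq_bigr => j _; rewrite !mxE mulrCA mulrA.
by rewrite mulrC mulrA [_ * r]mulrC.
Qed.

(** The energy picks up [(c r)^p] from the gradient, whose length [Q^T] preserves, and [r^(-n)] from
    the change of variables; the root of order [p] gives the exponent [1 - n/p]. *)
Lemma norm_Du_similarity (v : 'rV[R]_n -> R) (c : R) : D1p p v -> 0 < c ->
  norm_Du p (fun x => c * v (T x)) = ((c * r `^ (1 - n%:R / p))%:E * norm_Du p v)%E.
Proof.
move=> Dv c0; have [Dw Ew] := D1p_similarity c Dv.
have mGv := measurable_weak_grad Dv.
have mGT : measurable_fun setT (fun x => (c * r) *: (weak_grad v (T x) *m Q^T)).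
  apply: (measurableT_comp (f := fun y : 'rV[R]_n => (c * r) *: (y *m Q^T))
    (g := weak_grad v \o T)).
    apply: continuous_measurable_rV_rV => y.
    apply: (@continuous_comp _ _ _ (fun y : 'rV[R]_n => y *m Q^T) (fun y => (c * r) *: y)).
      exact: continuous_mulmxr.
    exact: scaler_continuous.
  by apply: measurableT_comp => //; exact: measurable_similarity.
rewrite !norm_DuE (ae_eq_energy p (measurable_weak_grad Dw) mGT Ew).
have cr0 : 0 < c * r by rewrite mulr_gt0.
have QTQ1 : Q^T *m Q^T^T = 1%:M by rewrite trmxK; exact: mulmx1C.
have -> : energy p (fun x => (c * r) *: (weak_grad v (T x) *m Q^T)) =
    (((c * r) `^ p * r^-1 ^+ n)%:E * energy p (weak_grad v))%E.
  rewrite EFinM -muleA -[in RHS](ge0_integral_similarity b r0 QQ1); last 2 first.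
  - by apply/measurable_EFinP; exact: measurable_enorm_powR.
  - by move=> x; rewrite lee_fin powR_ge0.
  rewrite -ge0_integralZl_EFin ?powR_ge0//; last 2 first.
  - by move=> x _; rewrite lee_fin powR_ge0.
  - by apply/measurable_EFinP; apply: measurable_enorm_powR;
      apply: measurableT_comp => //; exact: measurable_similarity.
  apply: eq_integral => x _; rewrite enormZ enorm_mulmx// gtr0_norm//.
  by rewrite [in LHS]powRM ?enorm_ge0 ?(ltW cr0)// EFinM.
rewrite poweRM ?energy_ge0 ?lee_fin ?mulr_ge0 ?powR_ge0 ?exprn_ge0 ?invr_ge0 ?(ltW r0)//.
congr (_ * _)%E; rewrite poweR_EFin; congr EFin.
rewrite powRM ?powR_ge0 ?exprn_ge0 ?invr_ge0 ?(ltW r0)//.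
rewrite -powRrM divff ?gt_eqF// powRr1 ?(ltW cr0)//.
rewrite exprVn -powR_mulrn ?(ltW r0)// -powRN -powRrM -mulrA; congr (_ * _).
by rewrite powRB ?powRr1 ?(ltW r0)// ?(gt_eqF r0) ?implybT// mulNr powRN.
Qed.

End similarity_invariance.

(** * Extremals *)

Section extremals.
Variables (R : realType) (n : nat) (p : R).
Implicit Types (u v w : 'rV[R]_n -> R) (x y : 'rV[R]_n) (C N s : R).

Lemma enorm_gt0 x : x != 0 -> 0 < enorm x.
Proof.
move=> x0; rewrite lt_neqAle enorm_ge0 andbT eq_sym.
by apply: contra x0 => /eqP /enorm_eq0 ->.
Qed.

Lemma holder_quotient_le u x y : x != y ->
  ((holder_quotient p u x y)%:E <= holder_seminorm p u)%E.
Proof. by move=> xy; apply: ereal_sup_ubound; exists (x, y). Qed.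

Lemma holder_seminorm_gt0 u : nonconstant u -> (0 < holder_seminorm p u)%E.
Proof.
move=> ncu.
have [x ux] : exists x, u x != u 0.
  apply: contrapT => h; apply: ncu; exists (u 0) => x.
  by apply: contra_notP h => /eqP; exists x.
have x0 : x != 0 by apply: contra ux => /eqP ->.
apply: lt_le_trans (holder_quotient_le u x0).
rewrite lte_fin divr_gt0// ?normr_gt0 ?subr_eq0// powR_gt0// enorm_gt0//.
by rewrite subr0.
Qed.

(** The product of the Morrey constant and the Dirichlet norm equals [s], which is real and
    positive. An extended product with an infinite factor is 0 or infinite, so both factors are
    real, and positive since the norm is nonnegative. *)
Lemma extremal_fin u s : extremal p u -> nonconstant u ->
  holder_seminorm p u = s%:E ->
  exists C N, [/\ morrey_const n p = C%:E, norm_Du p u = N%:E, 0 < C, 0 < N & s = C * N].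
Proof.
move=> [Du eu] /holder_seminorm_gt0; rewrite eu => s0 sE; move: s0; rewrite sE lte_fin => s0.
have N0 : (0 <= norm_Du p u)%E by exact: Lnorm_ge0.
have sN0 : s%:E <> 0%E by move=> -[sN]; rewrite sN ltxx in s0.
case: (morrey_const n p) sE => [C||]; case: (norm_Du p u) N0 => [N||] //=.
- rewrite lee_fin => N0 [CN]; exists C, N.
  have N1 : 0 < N.
    by rewrite lt_neqAle N0 andbT; apply/eqP => N00; apply: sN0; rewrite -CN -N00 mulr0.
  by split=> //; rewrite -(@pmulr_lgt0 _ N)// CN.
- move=> _; have [C0|C0|->] := ltgtP C 0.
  + by rewrite lt0_muley.
  + by rewrite gt0_muley.
  by rewrite mul0e => /esym.
- rewrite lee_fin le_eqVlt => /predU1P[<-|N0]; first by rewrite mule0 => /esym.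
  by rewrite gt0_mulye.
- rewrite lee_fin le_eqVlt => /predU1P[<-|N0]; first by rewrite mule0 => /esym.
  by rewrite gt0_mulNye.
Qed.

(** The infimum is itself admissible: for [N > 0] divide by [N] and pass to the infimum. For
    [N = 0], the case needed for [u - w], any admissible constant gives the bound 0, and one exists
    because the infimum of the empty set is [+oo]. *)
Lemma morrey_const_le w C N : D1p p w -> morrey_const n p = C%:E ->
  norm_Du p w = N%:E -> (holder_seminorm p w <= (C * N)%:E)%E.
Proof.
move=> Dw CE NE.
have N0 : 0 <= N by rewrite -lee_fin -NE; exact: Lnorm_ge0.
have le C' : morrey_inequality n p C' -> (holder_seminorm p w <= (C' * N)%:E)%E.
  by move=> /(_ w Dw); rewrite NE EFinM.
move: N0; rewrite le_eqVlt => /predU1P[N0|N0].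
  have [C' hC'] : exists C', morrey_inequality n p C'.
    apply: contrapT => h; have : morrey_const n p = +oo%E; last by rewrite CE.
    rewrite /morrey_const (_ : [set _ | _ in _] = set0) ?ereal_inf0//.
    by apply/seteqP; split=> // t [C' hC' tC']; apply: h; exists C'.
  by have := le _ hC'; rewrite -N0 !mulr0.
rewrite EFinM -lee_pdivrMr// -CE; apply/ereal_infP => _ [C' hC' <-].
by rewrite lee_pdivrMr// -EFinM; exact: le.
Qed.

End extremals.

(** Here [a], [b] stand for the increments of [u], [v] and [s], [t] for the powers of the two
    distances: the left side is the Morrey constant times the Dirichlet norm of [w], the right side
    the seminorm of [u]. *)
Lemma scaled_increment (F : fieldType) (a b s t : F) : b != 0 -> s != 0 -> t != 0 ->
  a / b * (t / s) * (b / t) = a / s.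
Proof. by move=> b0 s0 t0; field; rewrite b0 s0 t0. Qed.

Theorem proposition3p1 (R : realType) (n : nat) (p : R)
    (hn : (1 <= n)%N) (hp : n%:R < p)
    (x0 y0 x1 y1 : 'rV[R]_n) (hxy0 : x0 <> y0) (hxy1 : x1 <> y1)
    (u v : 'rV[R]_n -> R)
    (hu : extremal p u) (hv : extremal p v)
    (ncu : nonconstant u) (ncv : nonconstant v)
    (hux : holder_seminorm p u =
       ((u x0 - u y0) / enorm (x0 - y0) `^ (1 - n%:R / p))%:E)
    (hvx : holder_seminorm p v =
       ((v x1 - v y1) / enorm (x1 - y1) `^ (1 - n%:R / p))%:E)
    (O : {linear 'rV[R]_n -> 'rV[R]_n}) (hO : orthogonal_transformation O)
    (hOxy : O ((enorm (y0 - x0))^-1 *: (y0 - x0)) =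
            (enorm (y1 - x1))^-1 *: (y1 - x1))
    (x : 'rV[R]_n) :
  u x = (u y0 - u x0) / (v y1 - v x1) *
        (v ((enorm (x1 - y1) / enorm (x0 - y0)) *: O (x - x0) + x1) - v x1)
        + u x0.
Proof.
have p1 : 1 < p by apply: le_lt_trans hp; rewrite ler1n.
have p0 : 0 < p by exact: lt_trans p1.
have enormC (a b : 'rV[R]_n) : enorm (a - b) = enorm (b - a).
  by rewrite -opprB -scaleN1r enormZ normrN1 mul1r.
rewrite (enormC y0) (enormC y1) in hOxy.
set d0 := enorm (x0 - y0) in hux hOxy *; set d1 := enorm (x1 - y1) in hvx hOxy *.
have d0_gt0 : 0 < d0 by apply: enorm_gt0; rewrite subr_eq0; exact/eqP.
have d1_gt0 : 0 < d1 by apply: enorm_gt0; rewrite subr_eq0; exact/eqP.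
set al := 1 - n%:R / p in hux hvx.
have d0al : 0 < d0 `^ al by exact: powR_gt0.
have d1al : 0 < d1 `^ al by exact: powR_gt0.
have id0 : 0 < (d0 `^ al)^-1 by rewrite invr_gt0.
have id1 : 0 < (d1 `^ al)^-1 by rewrite invr_gt0.
have [C [N [CE NE C0 N0 sE]]] := extremal_fin hu ncu hux.
have [C' [Nv [C'E NvE _ Nv0 svE]]] := extremal_fin hv ncv hvx.
move: C'E; rewrite CE => -[C'E]; subst C'.
(* The attained quotients carry no absolute value, so the positivity of the seminorms fixes the
   signs of both increments; this makes [c] positive. *)
have ux : 0 < u x0 - u y0.
  by move: (mulr_gt0 C0 N0); rewrite -sE (pmulr_lgt0 _ id0).
have vx : 0 < v x1 - v y1.
  by move: (mulr_gt0 C0 Nv0); rewrite -svE (pmulr_lgt0 _ id1).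
set c := (u y0 - u x0) / (v y1 - v x1).
have cE : c = (u x0 - u y0) / (v x1 - v y1) by rewrite /c -opprB -(opprB (v x1)) invrN mulrNN.
have c0 : 0 < c by rewrite cE divr_gt0.
pose r := d1 / d0; have r0 : 0 < r by rewrite divr_gt0.
pose Q := lin1_mx O.
have OQ z : O z = z *m Q by rewrite mul_rV_lin1.
have QQ1 : Q *m Q^T = 1%:M.
  apply/matrixP => i j; rewrite [RHS]mxE mxE.
  have h := hO (delta_mx ord0 i) (delta_mx ord0 j).
  transitivity (dotp (row i Q) (row j Q)).
    by apply: eq_bigr => k _; rewrite !mxE.
  rewrite !rowE -!OQ h dotpE trmx_delta mul_delta_mx_cond !mulmxnE !mxE !eqxx.
  by [].
(* This offset sends [x0] to [x1]; the ratio [r] and the condition on [O] then send [y0] to [y1]. *)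
pose b := x1 - r *: O x0.
pose w z := c * v (similarity r Q b z).
have TE z : similarity r Q b z = r *: O (z - x0) + x1.
  by rewrite /similarity /b -OQ linearB scalerBr addrCA addrC.
have Tx0 : similarity r Q b x0 = x1 by rewrite TE subrr linear0 scaler0 add0r.
have Ty0 : similarity r Q b y0 = y1.
  have -> : similarity r Q b y0 = d1 *: O (d0^-1 *: (y0 - x0)) + x1.
    by rewrite TE linearZ scalerA.
  by rewrite hOxy scalerA divff ?gt_eqF// scale1r subrK.
have [Du _] := hu; have [Dv _] := hv.
have [Dw _] := D1p_similarity p1 b r0 QQ1 c Dv.
have dw : w x0 - w y0 = u x0 - u y0.
  by rewrite /w Tx0 Ty0 -mulrBr cE divfK// gt_eqF.
(* The equality is checked after multiplication by [C], which turns [C * Nv] and [C * N] into the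
   known Hölder quotients of [v] and [u]. *)
have wN : norm_Du p w = N%:E.
  rewrite (norm_Du_similarity p1 b r0 QQ1 Dv c0) NvE -EFinM; congr EFin.
  apply: (mulfI (lt0r_neq0 C0)); rewrite -sE mulrCA -svE -/al cE.
  have -> : r `^ al = d1 `^ al / d0 `^ al.
    rewrite -[in RHS](divfK (lt0r_neq0 d0_gt0) d1) (powRM _ (ltW r0) (ltW d0_gt0)).
    by rewrite (mulfK (lt0r_neq0 d0al)).
  exact: scaled_increment (lt0r_neq0 vx) (lt0r_neq0 d0al) (lt0r_neq0 d1al).
have [Dz Ez] := D1p_lin p1 2^-1 2^-1 Du Dw.
set z := fun t => 2^-1 * u t + 2^-1 * w t in Dz Ez.
have zle : (N%:E <= norm_Du p z)%E.
  have xy0 : x0 != y0 by exact/eqP.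
  case zE : (norm_Du p z) => [M||].
  - rewrite lee_fin -(ler_pM2l C0) -sE -lee_fin.
    apply: le_trans (morrey_const_le Dz CE zE).
    apply: le_trans (holder_quotient_le p z xy0).
    rewrite lee_fin /holder_quotient -/al -/d0.
    have -> : z x0 - z y0 = u x0 - u y0.
      by move: dw; rewrite /z; clear; lra.
    by rewrite gtr0_norm.
  - by rewrite leey.
  - by have := Lnorm_ge0 (@lebesgue_rV R n) p%:E (fun x => (enorm (weak_grad z x))%:E);
      rewrite -/(norm_Du p z) zE.
have mu' := measurable_weak_grad Du; have mw' := measurable_weak_grad Dw.
have grad_eq : {ae lebesgue_rV, forall t, weak_grad u t = weak_grad w t}.
  apply: (energy_strictly_convex p1 (N := N `^ p) mu' mw').
  - by rewrite (energyE p1) NE.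
  - by rewrite (energyE p1) wN.
  have <- : energy p (weak_grad z) =
      energy p (fun t => 2^-1 *: (weak_grad u t + weak_grad w t)).
    rewrite (ae_eq_energy p _ (measurable_rV_lin 2^-1 2^-1 mu' mw') Ez).
      by congr (energy p _); apply/funext => t; rewrite scalerDr.
    exact: measurable_weak_grad Dz.
  rewrite (energyE p1) -poweR_EFin; apply: gt0_ler_poweR => //.
  - exact: ltW.
  - by rewrite in_itv /= leey lee_fin ltW.
  by rewrite in_itv /= leey Lnorm_ge0.
have [Dd Ed] := D1p_lin p1 1 (-1) Du Dw.
set d := fun t => 1 * u t + -1 * w t in Dd Ed.
have dN : norm_Du p d = 0%:E.
  rewrite norm_DuE (ae_eq_energy p (H := cst 0)) //; last 2 first.
  - exact: measurable_weak_grad Dd.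
  - by apply: filterS2 Ed grad_eq => t -> ->; rewrite scale1r scaleN1r subrr.
  rewrite /energy; under eq_integral do rewrite enorm0 powR0 ?gt_eqF//.
  by rewrite integral0 poweR0r// invr_neq0 ?gt_eqF.
have hd := morrey_const_le Dd CE dN.
have d_const t : d t = d x0.
  have [->//|tx0] := eqVneq t x0.
  have := le_trans (holder_quotient_le p d tx0) hd.
  rewrite mulr0 lee_fin /holder_quotient pmulr_lle0 ?invr_gt0 ?powR_gt0 ?enorm_gt0 ?subr_eq0//.
  by rewrite normr_le0 subr_eq0 => /eqP.
(* Since [T] sends [x0] to [x1], the constant value of [u - w] is [u x0 - c * v x1]; solving for
   [u x] gives the stated identity. *)
have := d_const x; rewrite /d !mul1r !mulN1r /w Tx0 TE -/r => /(canRL (subrK _)) ->.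
by rewrite mulrBr [RHS]addrC [X in _ = _ + X]addrC addrA.
Qed.
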